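(* Let $X$ be a complex Banach space, let $0\ne\omega\in\mathbb R$, $2\le r\in\mathbb R$, and let $A$ be a set of functions with $BUC(J,X)\subset A\subset UC(J,X)$. Then $$g_{\omega,r}A\subset M(g_{\omega,r}BUC(J,X))\subset M(g_{\omega,r}A).$$
   Context: $X\ne\{0\}$; $J$ is $[\alpha,\infty)$, $(\alpha,\infty)$ ($\alpha\in\mathbb R$) or $\mathbb R$. $g_{\omega,r}(t)=e^{i\omega|t|^r}$. $UC(J,X)$, $BUC(J,X)$: uniformly continuous, bounded uniformly continuous functions $J\to X$. $L^1_{\rm loc}(J,X)$: all functions $J\to X$ (not equivalence classes) Bochner–Lebesgue integrable over every compact interval contained in $J$. $(M_hf)(t)=\frac1h\int_0^hf(t+s)\,ds$ for $h>0$; $MB=\{f\in L^1_{\rm loc}(J,X):M_hf\in B\text{ for all }h>0\}$ for $B\subset X^J$. $\gamma A=\{\gamma f:f\in A\}$. *)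

(* Defs.v *)
From HB Require Import structures.
From mathcomp Require Import all_boot all_order all_algebra.
From mathcomp Require Import complex.
From mathcomp Require Import all_classical all_reals all_analysis.
Set Implicit Arguments.
Unset Strict Implicit.
Unset Printing Implicit Defensive.
Import Order.TTheory GRing.Theory Num.Theory.
Import numFieldNormedType.Exports.
Local Open Scope classical_set_scope.
Local Open Scope complex_scope.
Local Open Scope ring_scope.

(* The norm of a normed space over R[i] takes values in R[i], where it is a
   nonnegative real; rnorm is that real number. *)
Definition rnorm {R : realType} {X : normedModType R[i]} (x : X) : R :=
  complex.Re `|x|.

Section Bochner.
Context {d : measure_display} {T : measurableType d} {R : realType}.
Context {X : normedModType R[i]}.
Variables (mu : {measure set T -> \bar R}) (D : set T).

Definition simple_on (s : T -> X) : Prop :=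
  [/\ finite_set (range s),
      forall x, measurable (s @^-1` [set x]) &
      forall x, x != 0 -> (mu (D `&` s @^-1` [set x]) < +oo)%E].

(* For x = 0 the measure may be infinite, but then the term vanishes. *)
Definition simple_integral (s : T -> X) : X :=
  \sum_(x \in range s) (fine (mu (D `&` s @^-1` [set x])))%:C *: x.

(* s is a sequence of simple functions witnessing that f is strongly
   measurable and Bochner integrable on D. *)
Definition bochner_approx (f : T -> X) (s : nat -> T -> X) : Prop :=
  [/\ forall n, simple_on (s n),
      {ae mu, forall t, D t -> s n t @[n --> \oo] --> f t} &
      (\int[mu]_(t in D) (rnorm (f t - s n t))%:E)%E @[n --> \oo] --> 0%E].

Definition bochner_integrable (f : T -> X) : Prop :=
  exists s, bochner_approx f s.

Definition is_bochner_integral (f : T -> X) (v : X) : Prop :=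
  exists2 s, bochner_approx f s &
    simple_integral (s n) @[n --> \oo] --> v.

(* Equal to 0 when f has no integral. *)
Definition bochner_integral (f : T -> X) : X :=
  xget 0 [set v | is_bochner_integral f v].

End Bochner.

Section FunctionSpaces.
Context {R : realType} {X : normedModType R[i]}.

Definition admissible_domain (J : set R) : Prop :=
  (exists a : R, J = `[a, +oo[%classic \/ J = `]a, +oo[%classic) \/ J = setT.

Variable J : set R.

(* J -> X is the type of functions on the subtype of R carved out by J, with
   its induced uniform structure. *)
Definition UC : set (J -> X) := [set f | unif_continuous f].

Definition BUC : set (J -> X) := [set f | UC f /\ bounded_fun f].

(* 'valL_0 f is the extension of f : J -> X to R by 0. The completed Lebesgue
   measure is used, so that f may be altered on any null set. *)
Definition L1loc : set (J -> X) := [set f | forall a b : R,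
  `[a, b]%classic `<=` J ->
  bochner_integrable completed_lebesgue_measure `[a, b]%classic ('valL_0 f)].

(* For the domains considered, t \in J and 0 <= s <= h imply t + s \in J, so
   the extension by 0 plays no role. *)
Definition mean (h : R) (f : J -> X) : J -> X := fun t =>
  (h^-1)%:C *: bochner_integral completed_lebesgue_measure `[0, h]%classic
                 (fun s => 'valL_0 f (set_val t + s)).

Definition mean_class (B : set (J -> X)) : set (J -> X) :=
  [set f | L1loc f /\ forall h : R, 0 < h -> B (mean h f)].

Definition mul_class (g : R -> R[i]) (B : set (J -> X)) : set (J -> X) :=
  [set (fun t : J => g (set_val t) *: f t) | f in B].

End FunctionSpaces.

Arguments UC {R} X J.
Arguments BUC {R} X J.

(* The function t |-> exp (i omega |t|^r), by Euler's formula. *)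
Definition chirp {R : realType} (omega r : R) (t : R) : R[i] :=
  cos (omega * `|t| `^ r) +i* sin (omega * `|t| `^ r).

(* Main.v *)
Require Import Defs.
From HB Require Import structures.
From mathcomp Require Import all_boot all_order all_algebra.
From mathcomp Require Import finmap complex.
From mathcomp Require Import all_classical all_reals all_analysis.
From mathcomp Require Import measurable_realfun ring lra.
Set Implicit Arguments.
Unset Strict Implicit.
Unset Printing Implicit Defensive.
Import Order.TTheory GRing.Theory Num.Theory.
Import numFieldNormedType.Exports.
Local Open Scope classical_set_scope.
Local Open Scope complex_scope.
Local Open Scope ring_scope.

(** Write g for the chirp and F = g f with f uniformly continuous on J.  The
    claim to prove is that the mean of F over a window of length h is g phi
    with phi bounded and uniformly continuous; the second inclusion is
    monotonicity of the two class operators.  Dividing by g is multiplying by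
    the chirp of frequency - omega, which gives phi (demodulated_mean).

    On a bounded part of J all the functions in sight are uniformly continuous
    and bounded, so only the behaviour of phi at infinity matters, where f may
    grow, but at most linearly (linear_growth).  There g oscillates with
    frequency of order |u|^(r-1) >= |u|, and the function
      Q u = g u / (i omega r sgn u |u|^(r-1))
    has derivative g up to an error O(|u|^-r).  Integration by parts gives
      int_t^(t+h) g f = Q (t+h) f (t+h) - Q t f t + o(1)    as |t| -> oo,
    although f need not be differentiable: the window is cut into N equal
    blocks on which f is nearly constant; on each block f is replaced by its
    value at the left end, where g is integrated exactly up to the error of Q,
    and each jump of f costs at most eps |Q|.  For fixed N, the product of this
    cost and N tends to 0 because Q does (riemann_block, riemann_by_parts,
    demodulated_mean_far).

    It remains to see the boundary terms.  If r > 2 then Q f = O(|u|^(2-r))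
    tends to 0, so phi does.  If r = 2 then Q f need not vanish at infinity, but
    after division by g the boundary terms are built from f u / u, which is
    bounded and uniformly continuous away from 0, and from the linear phase
    omega ((t+h)^2 - t^2) = omega (2 h t + h^2).

    The Bochner integral enters only through cvg_riemann_sum: for a uniformly
    continuous function on a segment it is the limit of the Riemann sums.  All
    later estimates are made on Riemann sums and passed to the limit. *)

(** * Modulus and norm as real numbers *)

Section ComplexModulus.
Context {R : realType}.
Implicit Types (c : R[i]) (a : R).

Definition cabs c : R := complex.Re `|c|.

Lemma cabs_ge0 c : 0 <= cabs c.
Proof. by rewrite /cabs normc_def /= sqrtr_ge0. Qed.

Lemma cabs_le c : cabs c <= `|complex.Re c| + `|complex.Im c|.
Proof.
rewrite /cabs normc_def /=.
rewrite -[leRHS]ger0_norm ?addr_ge0// -sqrtr_sqr ler_wsqrtr// sqrrD.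
by rewrite !real_normK ?num_real// -addrA lerD2l lerDr mulrn_wge0 ?mulr_ge0.
Qed.

Lemma cabsM c c' : cabs (c * c') = cabs c * cabs c'.
Proof. by rewrite /cabs normrM !normc_def -rmorphM. Qed.

Lemma cabsr a : cabs a%:C = `|a|.
Proof. by rewrite /cabs normc_def /= expr0n addr0 sqrtr_sqr. Qed.

Definition cis a : R[i] := cos a +i* sin a.

Lemma cabs_cis a : cabs (cis a) = 1.
Proof. by rewrite /cabs normc_def /= cos2Dsin2 sqrtr1. Qed.

Lemma cisD a b : cis (a + b) = cis a * cis b.
Proof. by rewrite /cis cosD sinD; simpc; rewrite [X in _ +i* X]addrC. Qed.

Lemma cis0 : cis 0 = 1.
Proof. by rewrite /cis cos0 sin0. Qed.

End ComplexModulus.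

Section RealNorm.
Context {R : realType} {X : normedModType R[i]}.
Implicit Types (x y : X) (a b : R).

Lemma rnormE x : `|x| = (rnorm x)%:C.
Proof. by rewrite /rnorm RRe_real ?normr_real. Qed.

Lemma rnorm_ge0 x : 0 <= rnorm x.
Proof. by have := normr_ge0 x; rewrite rnormE lecR. Qed.

Lemma rnorm0 : rnorm (0 : X) = 0.
Proof. by rewrite /rnorm normr0. Qed.

Lemma rnorm0_eq0 x : rnorm x = 0 -> x = 0.
Proof. by move=> x0; apply: normr0_eq0; rewrite rnormE x0. Qed.

Lemma rnormN x : rnorm (- x) = rnorm x.
Proof. by rewrite /rnorm normrN. Qed.

Lemma rnormD x y : rnorm (x + y) <= rnorm x + rnorm y.
Proof. by have := ler_normD x y; rewrite !rnormE -rmorphD lecR. Qed.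

Lemma rnormBC x y : rnorm (x - y) = rnorm (y - x).
Proof. by rewrite -rnormN opprB. Qed.

Lemma rnormB x y : rnorm (x - y) <= rnorm x + rnorm y.
Proof. by rewrite -[rnorm y]rnormN rnormD. Qed.

Lemma rnorm_dist3 z x y : rnorm (x - y) <= rnorm (x - z) + rnorm (z - y).
Proof. by rewrite -[x - y](subrKA z) rnormD. Qed.

Lemma rnorm_sum (I : Type) (s : seq I) (F : I -> X) :
  rnorm (\sum_(i <- s) F i) <= \sum_(i <- s) rnorm (F i).
Proof.
elim: s => [|i s ih]; first by rewrite !big_nil rnorm0.
by rewrite !big_cons (le_trans (rnormD _ _)) // lerD2l.
Qed.

Lemma rnormZ (c : R[i]) x : rnorm (c *: x) = cabs c * rnorm x.
Proof.
rewrite {1}/rnorm normrZ rnormE -[ `|c| ]RRe_real ?normr_real//.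
by rewrite -rmorphM.
Qed.

Lemma rnormZr a x : rnorm (a%:C *: x) = `|a| * rnorm x.
Proof. by rewrite rnormZ cabsr. Qed.

Lemma cvg_rnormP (u : nat -> X) (l : X) :
  u n @[n --> \oo] --> l <->
  forall e : R, 0 < e -> \forall n \near \oo, rnorm (l - u n) < e.
Proof.
split=> [/cvgrPdist_lt ul e e0|ul].
  have /ul : 0 < e%:C by rewrite ltcR.
  by apply: filterS => n; rewrite rnormE ltcR.
apply/cvgrPdist_lt => e e0.
have eE : e = (complex.Re e)%:C by rewrite RRe_real// gtr0_real.
move: e0; rewrite eE ltcR => /ul.
by apply: filterS => n; rewrite rnormE ltcR.
Qed.
End RealNorm.

Lemma cauchy_rnorm_cvg {R : realType} {X : completeNormedModType R[i]}
    (u : nat -> X) :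
  (forall e : R, 0 < e -> exists N, forall m n, (N <= m)%N -> (N <= n)%N ->
     rnorm (u m - u n) < e) ->
  exists l : X, u n @[n --> \oo] --> l.
Proof.
move=> cu; suff cvu : cvg (u @ \oo) by exists (lim (u @ \oo)).
apply/cauchy_cvgP/cauchy_ballP => e e0.
have eE : e = (complex.Re e)%:C by rewrite RRe_real// gtr0_real.
move: e0; rewrite eE ltcR => /cu[N uN].
exists ([set u n | n in [set n | N <= n]%N], [set u n | n in [set n | N <= n]%N]).
  by split; exists N => // n Nn; exists n.
move=> [_ _] /= [[m Nm <-] [n Nn <-]].
by rewrite -ball_normE /= rnormE ltcR uN.
Qed.

(** * Uniform continuity on a set of reals *)

Section UniformContinuity.
Context {R : realType} {X : normedModType R[i]}.
Implicit Types (D : set R) (F : R -> X).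

Definition unif_continuous_on D F := forall e : R, 0 < e ->
  exists2 d : R, 0 < d &
    forall x y, D x -> D y -> `|x - y| < d -> rnorm (F x - F y) <= e.

Lemma valLE (J : set R) (f : J -> X) (t : J) : 'valL_0 f (set_val t) = f t.
Proof. by have := congr1 (fun g => g f t) (sigL_valL (0 : X) (A := J)). Qed.

(** The uniform structure of J is induced from R, so it only sees the values of
    f on J and the extension by 0 is harmless. *)
Lemma UC_valL (J : set R) (f : J -> X) :
  UC X J f <-> unif_continuous_on J ('valL_0 f).
Proof.
split.
- move=> fU e e0.
  have : entourage [set xy : X * X | rnorm (xy.1 - xy.2) < e].
    rewrite -entourage_ballE; exists e%:C; first by rewrite /= ltcR.
    by move=> -[x y]; rewrite /= -ball_normE /= rnormE ltcR.
  move=> /fU [V entV sV]; move: entV; rewrite -entourage_ballE => -[d /= d0 dV].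
  exists d => // x y Jx Jy xyd.
  pose x' : J := exist _ x (mem_set Jx); pose y' : J := exist _ y (mem_set Jy).
  have := sV (x', y') (dV (x, y) _); rewrite /= -ball_normE /=.
  by move=> /(_ xyd); rewrite -(valLE f x') -(valLE f y') => /ltW.
- move=> fU E; rewrite -entourage_ballE => -[e /= e0 eE].
  have eR : e = (complex.Re e)%:C by rewrite RRe_real// gtr0_real.
  have e20 : 0 < complex.Re e / 2 by move: e0; rewrite eR ltcR /= => e0; lra.
  have [d d0 fd] := fU _ e20.
  exists [set xy : R * R | ball xy.1 d xy.2].
    by rewrite -entourage_ballE; exists d.
  move=> -[x y] /=; rewrite -ball_normE /= => xyd; apply: eE => /=.
  rewrite -ball_normE /= rnormE eR ltcR -(valLE f x) -(valLE f y).
  have Jz (z : J) : J (set_val z) by exact: set_valP.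
  by rewrite (le_lt_trans (fd _ _ (Jz x) (Jz y) xyd))//; lra.
Qed.

Lemma BUC_valL (J : set R) (f : J -> X) :
  BUC X J f <-> unif_continuous_on J ('valL_0 f) /\
    exists M, forall x, J x -> rnorm ('valL_0 f x) <= M.
Proof.
split=> -[/UC_valL fU fB]; split=> //.
- case: fB => M [Mr fM]; exists (complex.Re M + 1) => x Jx.
  have : M < (complex.Re M + 1)%:C.
    by rewrite -[ltLHS]RRe_real// ltcR ltrDl.
  pose x' : J := exist _ x (mem_set Jx).
  by move=> /fM /(_ x' I) /=; rewrite -(valLE f x') rnormE lecR.
- case: fB => M fM; exists M%:C; split; first by rewrite complex_real.
  move=> N MN t _; rewrite /= -(valLE f t) rnormE.
  rewrite (le_trans _ (ltW MN))// lecR fM//.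
  exact: set_valP.
Qed.

End UniformContinuity.

Section UniformContinuityCalculus.
Context {R : realType} {X : normedModType R[i]}.
Implicit Types (D : set R) (f phi : R -> X).

(** The variation of c is multiplied by the size of f, hence the bound M. *)
Lemma unif_continuous_on_scale D (c : R -> R[i]) f (L M : R) :
  0 <= L -> 0 <= M ->
  (forall x, D x -> cabs (c x) <= 1) ->
  (forall x y, D x -> D y -> cabs (c x - c y) <= L * `|x - y|) ->
  (forall x, D x -> rnorm (f x) <= M) ->
  unif_continuous_on D f -> unif_continuous_on D (fun x => c x *: f x).
Proof.
move=> L0 M0 c1 cL fM uf e e0; have e20 : 0 < e / 2 by lra.
have [d d0 fd] := uf _ e20.
have LM0 : 0 <= L * M by rewrite mulr_ge0.
have d'0 : 0 < e / 2 / (L * M + 1) by rewrite divr_gt0// ltr_wpDl.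
(* the summand 1 avoids a division by L * M = 0 *)
exists (Num.min d (e / 2 / (L * M + 1))); first by rewrite lt_min d0.
move=> x y Dx Dy; rewrite lt_min => /andP[xyd xyd'].
have -> : c x *: f x - c y *: f y = c x *: (f x - f y) + (c x - c y) *: f y.
  by rewrite scalerBr scalerBl addrA subrK.
have -> : e = e / 2 + e / 2 by lra.
rewrite (le_trans (rnormD _ _))// !rnormZ lerD//.
- by rewrite -[leRHS]mul1r ler_pM ?cabs_ge0 ?rnorm_ge0 ?c1 ?fd.
- apply: (@le_trans _ _ (L * `|x - y| * M)).
    by rewrite ler_pM ?cabs_ge0 ?rnorm_ge0 ?cL ?fM.
  rewrite mulrAC; move: xyd'; rewrite ltr_pdivlMr ?ltr_wpDl//.
  by move=> /ltW; apply: le_trans; rewrite mulrC ler_wpM2l// lerDl.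
Qed.

Lemma unif_continuous_onB D f phi :
  unif_continuous_on D f -> unif_continuous_on D phi ->
  unif_continuous_on D (fun x => f x - phi x).
Proof.
move=> uf uphi e e0; have e20 : 0 < e / 2 by lra.
have [d d0 fd] := uf _ e20; have [d' d'0 phid] := uphi _ e20.
exists (Num.min d d') => [|x y Dx Dy]; first by rewrite lt_min d0.
rewrite lt_min => /andP[xyd xyd'].
have -> : f x - phi x - (f y - phi y) = (f x - f y) - (phi x - phi y).
  by rewrite !opprD !opprK addrACA.
have -> : e = e / 2 + e / 2 by lra.
by rewrite (le_trans (rnormB _ _))// lerD ?fd ?phid.
Qed.

Lemma unif_continuous_on_sub D D' f :
  D' `<=` D -> unif_continuous_on D f -> unif_continuous_on D' f.
Proof.
move=> D'D uf e e0; have [d d0 fd] := uf e e0.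
by exists d => // x y /D'D Dx /D'D Dy; exact: fd.
Qed.

Definition unif_continuous_far D phi := forall e : R, 0 < e ->
  exists T, exists2 d : R, 0 < d & forall x y, D x -> D y ->
    T <= `|x| -> T <= `|y| -> `|x - y| < d -> rnorm (phi x - phi y) <= e.

(** Points at distance less than 1 lie either both in the ball of radius T + 1
    or both outside the ball of radius T. *)
Lemma unif_continuous_glue D phi :
  (forall S, unif_continuous_on (D `&` [set x | `|x| <= S]) phi) ->
  unif_continuous_far D phi -> unif_continuous_on D phi.
Proof.
move=> near far e e0; have [T [d d0 fard]] := far e e0.
have [d' d'0 neard] := near (T + 1) e e0.
exists (Num.min 1 (Num.min d d')); first by rewrite !lt_min ltr01 d0.
move=> x y Dx Dy; rewrite !lt_min => /and3P[xy1 xyd xyd'].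
have := ler_dist_dist x y; rewrite ler_norml => /andP[xy yx].
case: (leP T `|x|) => xT; last by apply: neard => //; split=> //=; lra.
case: (leP T `|y|) => yT; last by apply: neard => //; split=> //=; lra.
exact: fard.
Qed.

(** A point x of D is joined to a base point a by about |x - a| / e equal steps
    of length at most e inside D, and f moves by at most 1 at each step. *)
Lemma linear_growth D f :
  (forall x y, D x -> x <= y -> D y) -> unif_continuous_on D f ->
  exists2 C, 0 <= C & forall x, D x -> rnorm (f x) <= C * (1 + `|x|).
Proof.
move=> Dup uf; have [[a Da]|D0] := pselect (exists a, D a); last first.
  by exists 0 => // x Dx; case: D0; exists x.
have [d d0 fd] := uf 1 ltr01; pose e := d / 2.
have e0 : 0 < e by rewrite divr_gt0.
have step n x : D x -> `|x - a| <= n%:R * e -> rnorm (f x) <= rnorm (f a) + n%:R.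
  elim: n x => [|n ih] x Dx.
    by rewrite mul0r normr_le0 subr_eq0 => /eqP ->; rewrite addr0.
  (* one step of length |q| from x towards a; y stays in D because it lies to
     the right of a or of x *)
  move=> xa; pose q := (x - a) / n.+1%:R; pose y := x - q.
  have xaq : x - a = n.+1%:R * q by rewrite /q mulrC divfK// pnatr_eq0.
  have qe : `|q| <= e.
    by move: xa; rewrite xaq normrM normr_nat ler_pM2l// ltr0n.
  have yaq : y - a = n%:R * q.
    by rewrite /y addrAC xaq -natr1; ring.
  have Dy : D y.
    case: (leP 0 q) => q0.
      by apply: Dup Da _; rewrite -subr_ge0 yaq mulr_ge0.
    by apply: Dup Dx _; rewrite /y lerDl oppr_ge0 ltW.
  have ya : `|y - a| <= n%:R * e by rewrite yaq normrM normr_nat ler_wpM2l.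
  have xy : `|x - y| < d.
    by rewrite /y opprB addrC subrK (le_lt_trans qe)// /e; lra.
  have := ih y Dy ya; have := fd x y Dx Dy xy.
  have := rnormD (f x - f y) (f y); rewrite subrK -natr1; lra.
exists (rnorm (f a) + `|a| / e + 1 + e^-1).
  by rewrite !addr_ge0 ?rnorm_ge0 ?divr_ge0 ?invr_ge0// ltW.
move=> x Dx; have x0 : 0 <= `|x - a| / e by rewrite divr_ge0// ltW.
have /andP[n1 n2] := truncn_itv x0.
apply: le_trans (step (Num.truncn (`|x - a| / e)).+1 x Dx _) _.
  by rewrite -ler_pdivrMr// ltW.
have xa : `|x - a| / e <= `|x| / e + `|a| / e.
  by rewrite -mulrDl ler_wpM2r ?invr_ge0 ?ler_normB// ltW.
have fa0 := rnorm_ge0 (f a).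
have p1 : 0 <= (rnorm (f a) + `|a| / e + 1) * `|x|.
  by rewrite mulr_ge0// !addr_ge0// divr_ge0// ltW.
have p2 : 0 <= e^-1 by rewrite invr_ge0 ltW.
rewrite -natr1; move: n1 xa; rewrite ![_ / e]mulrC => n1 xa; nra.
Qed.

End UniformContinuityCalculus.

(** * Simple integrals and maps with finite range *)

Section FiniteRange.
Context {d : measure_display} {T : measurableType d} {R : realType}.
Context {X : normedModType R[i]}.
Variables (mu : {measure set T -> \bar R}) (D : set T).
Hypotheses (mD : measurable D) (muD : (mu D < +oo)%E).

(** Simple functions are handled through an arbitrary index map w with finitely
    many measurable fibres: a pair of simple functions, or the number of a grid
    cell, indexes the values of several functions at once. *)
Definition finite_map (Y : choiceType) (w : T -> Y) :=
  finite_set (range w) /\ forall y, measurable (w @^-1` [set y]).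

Definition fibre_mass (Y : choiceType) (w : T -> Y) (y : Y) : R :=
  fine (mu (D `&` w @^-1` [set y])).

Lemma measure_sub_fin (A : set T) : measurable A -> (mu (D `&` A) < +oo)%E.
Proof.
move=> mA; apply: le_lt_trans muD; apply: le_measure => //; rewrite inE//.
exact: measurableI.
Qed.

Lemma fibre_massE (Y : choiceType) (w : T -> Y) y : finite_map w ->
  (fibre_mass w y)%:E = mu (D `&` w @^-1` [set y]).
Proof. by move=> [_ mw]; rewrite fineK// ge0_fin_numE// measure_sub_fin. Qed.

Lemma fibre_mass_ge0 (Y : choiceType) (w : T -> Y) y : 0 <= fibre_mass w y.
Proof. exact: fine_ge0. Qed.

Lemma finite_map_preimage (Y : choiceType) (w : T -> Y) (B : set Y) :
  finite_map w -> measurable (w @^-1` B).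
Proof.
move=> [fw mw].
have -> : w @^-1` B = \bigcup_(y in range w `&` B) w @^-1` [set y].
  apply/seteqP; split=> [t Bt|t [y [_ By] wt]]; last by rewrite /preimage/= wt.
  by exists (w t) => //; split=> //; exists t.
by apply: fin_bigcup_measurable => //; exact: finite_setIl.
Qed.

Lemma finite_map_comp (Y Z : choiceType) (w : T -> Y) (phi : Y -> Z) :
  finite_map w -> finite_map (phi \o w).
Proof.
move=> fw; split; last by move=> z; rewrite comp_preimage; exact: finite_map_preimage.
by rewrite -(image_comp w phi); apply: finite_image; exact: fw.1.
Qed.

Lemma finite_map_pair (Y Z : choiceType) (w : T -> Y) (w' : T -> Z) :
  finite_map w -> finite_map w' -> finite_map (fun t => (w t, w' t)).
Proof.
move=> [fw mw] [fw' mw']; split.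
  apply: sub_finite_set (finite_setX fw fw').
  by move=> _ [t _ <-]; split; exists t.
move=> [y z].
have -> : (fun t => (w t, w' t)) @^-1` [set (y, z)] =
    w @^-1` [set y] `&` w' @^-1` [set z].
  by apply/seteqP; split=> [t [<- <-]|t [<- <-]].
exact: measurableI.
Qed.

Lemma measurable_finite_map (Y : choiceType) (w : T -> Y) (psi : Y -> R) :
  finite_map w -> measurable_fun D (psi \o w).
Proof.
move=> fw _ B mB; apply: measurableI => //; rewrite comp_preimage.
exact: finite_map_preimage.
Qed.

Lemma in_range_fset (Y : choiceType) (w : T -> Y) t :
  finite_map w -> w t \in fset_set (range w).
Proof. by move=> [fw _]; rewrite in_fset_set// inE; exists t. Qed.

Lemma sum_pick (V : nmodType) (Y : choiceType) (s : seq Y) (y0 : Y) (F : Y -> V) :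
  uniq s -> y0 \in s -> \sum_(y <- s) (if y0 == y then F y else 0) = F y0.
Proof.
move=> us y0s; rewrite (bigD1_seq y0)//= eqxx big1 ?addr0// => y.
by rewrite eq_sym => /negbTE ->.
Qed.

Lemma integral_finite_map (Y : choiceType) (w : T -> Y) (psi : Y -> R) :
  finite_map w -> (forall y, 0 <= psi y) ->
  (\int[mu]_(t in D) (psi (w t))%:E)%E =
  (\sum_(y <- fset_set (range w)) fibre_mass w y * psi y)%:E.
Proof.
move=> fw psi0; have mw := fw.2.
transitivity (\int[mu]_(t in D) \sum_(y <- fset_set (range w))
    (psi y * \1_(w @^-1` [set y]) t)%:E)%E.
  apply: eq_integral => t _; rewrite sumEFin; congr EFin.
  rewrite -(sum_pick psi (fset_uniq _) (in_range_fset t fw)).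
  apply: eq_bigr => y _; rewrite indicE.
  have -> : (t \in w @^-1` [set y]) = (w t == y).
    by apply/idP/eqP; rewrite inE.
  by case: eqP => _; rewrite ?mulr1 ?mulr0.
rewrite ge0_integral_sum//; first last.
- by move=> y t _; rewrite lee_fin mulr_ge0.
- move=> y; apply/measurable_EFinP; apply: measurable_funM.
    exact: measurable_cst.
  by apply: measurable_indic; exact: mw.
rewrite -sumEFin; apply: eq_bigr => y _.
rewrite (@integralZl_indic _ _ _ _ _ mD (fun=> w @^-1` [set y]))//; last first.
  by move=> /lt_geF; rewrite psi0.
by rewrite integral_indic// setIC EFinM fibre_massE// muleC.
Qed.

(** Additivity of the measure over the fibres of w, read off from the integral
    of the indicator of a fibre of phi \o w. *)
Lemma fibre_mass_comp (Y Z : choiceType) (w : T -> Y) (phi : Y -> Z) z :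
  finite_map w -> fibre_mass (phi \o w) z =
  \sum_(y <- fset_set (range w)) (if phi y == z then fibre_mass w y else 0).
Proof.
move=> fw; apply: EFin_inj; rewrite fibre_massE; last exact: finite_map_comp.
rewrite setIC -integral_indic//; last exact: (finite_map_comp phi fw).2.
transitivity (\int[mu]_(t in D) ((fun y => (phi y == z)%:R : R) (w t))%:E)%E.
  apply: eq_integral => t _; rewrite indicE.
  by congr ((_ : bool)%:R%:E); apply/idP/eqP; rewrite inE.
rewrite (@integral_finite_map _ _ (fun y => (phi y == z)%:R : R))//.
congr EFin; apply: eq_bigr => y _.
by case: eqP => _; rewrite ?mulr1 ?mulr0.
Qed.

(** The sum that defines the simple integral may be indexed by w instead of by
    the values; with w a pair of simple functions this is additivity. *)
Lemma simple_integral_comp (Y : choiceType) (w : T -> Y) (phi : Y -> X) :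
  finite_map w -> simple_integral mu D (phi \o w) =
  \sum_(y <- fset_set (range w)) (fibre_mass w y)%:C *: phi y.
Proof.
move=> fw; have fr := (finite_map_comp phi fw).1.
rewrite /simple_integral fsbig_finite//=.
under eq_bigr => x _.
  rewrite -[fine _]/(fibre_mass (phi \o w) x) fibre_mass_comp// rmorph_sum/=.
  rewrite scaler_suml.
  under eq_bigr => y _.
    have -> : (if phi y == x then fibre_mass w y else 0)%:C *: x =
      if phi y == x then (fibre_mass w y)%:C *: x else 0.
      by case: eqP => // _; rewrite scale0r.
  over.
over.
rewrite exchange_big /=; apply: eq_big_seq => y.
rewrite in_fset_set ?inE; last by case: fw.
move=> -[t _ <-]; apply: (sum_pick (fun x => (fibre_mass w (w t))%:C *: x)).
  exact: fset_uniq.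
exact: (in_range_fset t (finite_map_comp phi fw)).
Qed.

(** The integral is a contraction for the distance in mean: index both functions
    by the pair of their values and apply the triangle inequality. *)
Lemma simple_integral_dist (s r : T -> X) : finite_map s -> finite_map r ->
  ((rnorm (simple_integral mu D s - simple_integral mu D r))%:E <=
   \int[mu]_(t in D) (rnorm (s t - r t))%:E)%E.
Proof.
move=> fs fr; have fsr := finite_map_pair fs fr.
have -> : simple_integral mu D s = _ :=
  simple_integral_comp (fun p : X * X => p.1) fsr.
have -> : simple_integral mu D r = _ :=
  simple_integral_comp (fun p : X * X => p.2) fsr.
rewrite (@integral_finite_map _ _ (fun p : X * X => rnorm (p.1 - p.2)) fsr);
  last by move=> ?; exact: rnorm_ge0.
rewrite lee_fin -sumrB (le_trans (rnorm_sum _ _))//; apply: ler_sum => p _.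
by rewrite -scalerBr rnormZr ger0_norm// fibre_mass_ge0.
Qed.
End FiniteRange.

(** * Bochner integrals of uniform limits of simple functions *)

Section UniformLimit.
Context {d : measure_display} {T : measurableType d} {R : realType}.
Context {X : completeNormedModType R[i]}.
Variables (mu : {measure set T -> \bar R}) (D : set T).
Hypotheses (mD : measurable D) (muD : (mu D < +oo)%E).
Variables (f : T -> X) (r : nat -> T -> X).
Hypothesis fr : forall n, finite_map (r n).
Hypothesis rf : forall e : R, 0 < e ->
  \forall n \near \oo, forall t, D t -> rnorm (f t - r n t) <= e.

(** On D the function f is a pointwise limit of the r n, so its distance to s is
    a limit of functions with finitely many measurable fibres. *)
Lemma measurable_dist (s : T -> X) : finite_map s ->
  measurable_fun D (fun t => rnorm (f t - s t)).
Proof.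
move=> fs; apply: (@measurable_fun_cvg _ _ _ _
  (fun n t => rnorm (r n t - s t))) => [n|t Dt].
  exact: (measurable_finite_map mD (fun p : X * X => rnorm (p.1 - p.2))
    (finite_map_pair (fr n) fs)).
apply/cvgrPdist_le => e e0; apply: filterS (rf e0) => n /(_ t Dt).
have h1 := rnorm_dist3 (r n t) (f t) (s t).
have := rnorm_dist3 (f t) (r n t) (s t); rewrite (rnormBC (r n t) (f t)) => h2 h.
by rewrite ler_norml; apply/andP; split; lra.
Qed.

(** Compares any simple s with r n; as s stays arbitrary, the bound serves both
    for the convergence of the integrals and for the uniqueness of the limit. *)
Lemma simple_integral_dist_le (s : T -> X) (n : nat) (e : R) :
  finite_map s -> 0 <= e -> (forall t, D t -> rnorm (f t - r n t) <= e) ->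
  ((rnorm (simple_integral mu D s - simple_integral mu D (r n)))%:E <=
   \int[mu]_(t in D) (rnorm (f t - s t))%:E + e%:E * mu D)%E.
Proof.
move=> fs e0 re.
have mf : measurable_fun D (fun t => (rnorm (f t - s t))%:E).
  by apply/measurable_EFinP; exact: measurable_dist.
apply: (le_trans (simple_integral_dist mD muD fs (fr n))).
have <- : (\int[mu]_(t in D) ((rnorm (f t - s t))%:E + cst e%:E t) =
    \int[mu]_(t in D) (rnorm (f t - s t))%:E + e%:E * mu D)%E.
  rewrite ge0_integralD//; first by rewrite integral_cst.
  by move=> t _; rewrite lee_fin rnorm_ge0.
apply: ge0_le_integral => //.
- by move=> t _; rewrite lee_fin rnorm_ge0.
- apply/measurable_EFinP.
  exact: (measurable_finite_map mD (fun p : X * X => rnorm (p.1 - p.2))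
    (finite_map_pair fs (fr n))).
- exact: emeasurable_funD.
- move=> t Dt /=; rewrite lee_fin (le_trans (rnorm_dist3 (f t) _ _))//.
  by rewrite rnormBC lerD2l re.
Qed.

Lemma simple_on_finite_map (s : T -> X) : finite_map s -> simple_on mu D s.
Proof.
by move=> [fs ms]; split=> // x _; apply: (measure_sub_fin mD muD).
Qed.

Lemma integral_dist_le n (e : R) :
  0 <= e -> (forall t, D t -> rnorm (f t - r n t) <= e) ->
  (\int[mu]_(t in D) (rnorm (f t - r n t))%:E <= e%:E * mu D)%E.
Proof.
move=> e0 re; rewrite -(integral_cst mu mD); apply: ge0_le_integral => //=.
- by move=> t _; rewrite lee_fin rnorm_ge0.
- by apply/measurable_EFinP; exact: measurable_dist.
Qed.

Lemma near_small (e : R) : 0 < e -> exists e', [/\ 0 < e', (e'%:E * mu D <= e%:E)%E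
  & \forall n \near \oo, forall t, D t -> rnorm (f t - r n t) <= e'].
Proof.
move=> e0; have M0 : 0 <= fine (mu D) by exact: fine_ge0.
have e'0 : 0 < e / (fine (mu D) + 1) by rewrite divr_gt0// ltr_wpDl.
(* the summand 1 covers the case of a null set D *)
exists (e / (fine (mu D) + 1)); split=> //; last exact: rf.
rewrite -[mu D]fineK ?ge0_fin_numE// -EFinM lee_fin mulrAC ler_pdivrMr ?ltr_wpDl//.
by rewrite ler_wpM2l ?lerDl// ltW.
Qed.

Lemma uniform_bochner_approx : bochner_approx mu D f r.
Proof.
split.
- by move=> n; exact: simple_on_finite_map.
- apply: aeW => t Dt; apply/cvg_rnormP => e e0.
  have e20 : 0 < e / 2 by lra.
  apply: filterS (rf e20) => n /(_ t Dt) fe; apply: le_lt_trans fe _; lra.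
- apply/fine_cvgP; split.
    have [e' [e'0 _]] := near_small ltr01; apply: filterS => n re.
    rewrite ge0_fin_numE; last first.
      by apply: integral_ge0 => t _; rewrite lee_fin rnorm_ge0.
    apply: le_lt_trans (integral_dist_le (ltW e'0) re) _.
    by rewrite lte_mul_pinfty// ltW.
  apply/cvgrPdist_le => e e0; have [e' [e'0 e'e]] := near_small e0.
  apply: filterS => n re; rewrite sub0r normrN.
  have i0 : (0 <= \int[mu]_(t in D) (rnorm (f t - r n t))%:E)%E.
    by apply: integral_ge0 => t _; rewrite lee_fin rnorm_ge0.
  have ie := le_trans (integral_dist_le (ltW e'0) re) e'e.
  rewrite /= ger0_norm ?fine_ge0// -lee_fin fineK// ge0_fin_numE//.
  by rewrite (le_lt_trans ie)// ltry.
Qed.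

(** The simple integrals of the r n are Cauchy, hence converge to some v.  Any
    other sequence s of simple functions that approximates f in mean has its
    integrals close to those of the r n, so it gives the same v, and the choice
    made in bochner_integral is forced. *)
Lemma cvg_simple_integral :
  simple_integral mu D (r n) @[n --> \oo] --> bochner_integral mu D f.
Proof.
have [v rv] : exists v : X, simple_integral mu D (r n) @[n --> \oo] --> v.
  apply: cauchy_rnorm_cvg => e e0; have e30 : 0 < e / 3 by lra.
  have [e' [e'0 e'e [N _ rN]]] := near_small e30.
  exists N => m n Nm Nn; rewrite -lte_fin.
  apply: le_lt_trans (simple_integral_dist_le (fr m) (ltW e'0) (rN n Nn)) _.
  have le2 := leeD (integral_dist_le (ltW e'0) (rN m Nm)) (lexx (e'%:E * mu D)%E).
  apply: le_lt_trans le2 _; apply: le_lt_trans (leeD e'e e'e) _.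
  by rewrite -EFinD lte_fin; lra.
suff uniq v' : is_bochner_integral mu D f v' -> v' = v.
  suff -> : bochner_integral mu D f = v by [].
  apply: uniq; apply: (xgetPex 0); exists v.
  by exists r => //; exact: uniform_bochner_approx.
move=> [s [ss sf sI] sv'].
apply: subr0_eq; apply: rnorm0_eq0.
apply/eqP; rewrite eq_le rnorm_ge0 andbT; apply/ler_addgt0Pr => e e0.
rewrite add0r; have e40 : 0 < e / 4 by lra.
have [e' [e'0 e'e re']] := near_small e40.
have [n [rv4 rn]] : exists n, rnorm (v - simple_integral mu D (r n)) < e / 4 /\
    forall t, D t -> rnorm (f t - r n t) <= e'.
  have /cvg_rnormP/(_ _ e40) h := rv.
  by have [N _ H] := filterI h re'; exists N; exact: (H N (leqnn N)).
have [m [sv4 sm]] : exists m, rnorm (v' - simple_integral mu D (s m)) < e / 4 /\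
    (\int[mu]_(t in D) (rnorm (f t - s m t))%:E <= (e / 4)%:E)%E.
  have /cvg_rnormP/(_ _ e40) h := sv'.
  have h2 : \forall m \near \oo,
      (\int[mu]_(t in D) (rnorm (f t - s m t))%:E <= (e / 4)%:E)%E.
    move/fine_cvgP : sI => [sfin /cvgrPdist_le /(_ _ e40) sI].
    apply: filterS2 sfin sI => k kfin; rewrite sub0r normrN /= => /ler_normlW.
    by rewrite -lee_fin fineK.
  by have [N _ H] := filterI h h2; exists N; exact: (H N (leqnn N)).
have fsm : finite_map (s m) by case: (ss m) => ? ? _; split.
have := simple_integral_dist_le fsm (ltW e'0) rn.
move=> /le_trans /(_ (leeD sm e'e)); rewrite -EFinD lee_fin => srn.
have := rnorm_dist3 (simple_integral mu D (s m)) v' v.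
have := rnorm_dist3 (simple_integral mu D (r n)) (simple_integral mu D (s m)) v.
by rewrite (rnormBC (simple_integral mu D (r n)) v); lra.
Qed.

End UniformLimit.

(** * Riemann sums for the completed Lebesgue measure *)

Section RiemannSums.
Context {R : realType}.
Local Notation T := (caratheodory_type (wlength (@idfun R))^*%mu).
Local Notation mu := (@completed_lebesgue_measure R : {measure set T -> \bar R}).

Lemma completed_measurable_itv (i : interval R) :
  measurable ([set` i] : set T).
Proof. by apply: sub_caratheodory; exact: measurable_itv. Qed.

Lemma completed_measure_itv (i : interval R) :
  mu [set` i] = (if i.1 < i.2 then (i.2 : \bar R) - i.1 else 0)%E.
Proof. exact: lebesgue_measure_itv. Qed.

Lemma segment_measure_fin (a b : R) : (mu `[a, b]%classic < +oo)%E.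
Proof. by rewrite completed_measure_itv /= -EFinD; case: ifP; rewrite ltry. Qed.

Variables (a d : R) (n : nat).

(** The number of the cell of the grid a, a + d, ..., a + n d that contains u.
    The cap n makes the range finite; index n is only taken at the right end of
    the segment, a null set, and to its right. *)
Definition step_index (u : T) : nat := minn n (Num.truncn ((u - a) / d)).

Lemma finite_map_step_index : 0 < d -> finite_map step_index.
Proof.
move=> d0; split.
  apply: (@sub_finite_set _ _ `I_n.+1); last exact: finite_II.
  by move=> _ [u _ <-] /=; rewrite ltnS geq_minl.
move=> k.
have mge j : measurable [set u | (j <= step_index u)%N].
  case: j => [|j].
    rewrite [X in measurable X](_ : _ = setT); first exact: measurableT.
    by apply/seteqP; split.
  case: (leqP j.+1 n) => jn.
    rewrite [X in measurable X](_ : _ = `[a + j.+1%:R * d, +oo[%classic).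
      exact: completed_measurable_itv.
    apply/seteqP; split=> u /=; rewrite leq_min jn /= truncn_gt_nat;
      by rewrite ler_pdivlMr// lerBrDl in_itv/= andbT.
  rewrite [X in measurable X](_ : _ = set0); first exact: measurable0.
  by apply/seteqP; split=> u //=; rewrite leq_min leqNgt jn.
rewrite (_ : _ @^-1` _ = [set u | (k <= step_index u)%N] `\`
    [set u | (k.+1 <= step_index u)%N]); first exact: measurableD.
apply/seteqP; split=> u /=; first by move=> ->; rewrite ltnn; split.
by move=> [ku /negP]; rewrite -leqNgt => uk; apply/eqP; rewrite eqn_leq uk.
Qed.

Local Notation D := (`[a, a + n%:R * d]%classic : set T).

Lemma step_index_close (u : R) : 0 < d -> D u ->
  D (a + (step_index u)%:R * d) /\
  `|u - (a + (step_index u)%:R * d)| < d.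
Proof.
move=> d0; rewrite /= !in_itv /= => /andP[au ub].
have x0 : 0 <= (u - a) / d by rewrite divr_ge0 ?subr_ge0//; exact: ltW.
rewrite /step_index; set k := Num.truncn _.
have : k%:R <= (u - a) / d < k.+1%:R by exact: truncn_itv.
rewrite ler_pdivlMr// ltr_pdivrMr// => /andP[ku uk].
case: (leqP n k) => nk.
- have nkR : n%:R * d <= k%:R * d by rewrite ler_wpM2r ?ler_nat// ltW.
  have -> : u = a + n%:R * d by lra.
  by rewrite subrr normr0; split => //; rewrite lexx andbT lerDl mulr_ge0// ltW.
- have knR : k%:R * d <= n%:R * d.
    by rewrite ler_pM2r// ler_nat ltnW.
  split; first by rewrite lerDl lerD2l knR andbT mulr_ge0// ltW.
  move: uk; rewrite -natr1 mulrDl mul1r => uk.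
  by rewrite ltr_norml; apply/andP; split; lra.
Qed.

Lemma step_index_mass k : 0 < d -> fibre_mass mu D step_index k =
  if (k < n)%N then d else 0.
Proof.
move=> d0; rewrite /fibre_mass.
have fib u : D u -> ((k < n)%N -> (step_index u = k) <->
    (a + k%:R * d <= u < a + k.+1%:R * d)) /\
    (k = n -> (step_index u = k) <-> (u = a + n%:R * d)).
  rewrite /= in_itv /= => /andP[au ub].
  have x0 : 0 <= (u - a) / d by rewrite divr_ge0 ?subr_ge0//; exact: ltW.
  rewrite /step_index; split.
    move=> kn.
    have -> : (a + k%:R * d <= u < a + k.+1%:R * d) =
        (Num.truncn ((u - a) / d) == k).
      by rewrite truncn_eq// ler_pdivlMr// ltr_pdivrMr// lerBrDl ltrBlDl.
    split; last by move=> /eqP ->; apply/minn_idPr; exact: ltnW.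
    by case: (leqP n) => [_ nk|_ ->//]; move: kn; rewrite nk ltnn.
  move=> ->; split.
    move=> /minn_idPl; rewrite truncn_ge_nat// ler_pdivlMr// => nu; lra.
  move=> un; apply/minn_idPl; rewrite truncn_ge_nat// ler_pdivlMr//; lra.
case: (ltngtP k n) => [kn|nk|kn].
- have kR : (k.+1%:R * d <= n%:R * d :> R) by rewrite ler_wpM2r ?ler_nat// ltW.
  have k0 : 0 <= k%:R * d by rewrite mulr_ge0// ltW.
  rewrite (_ : _ `&` _ = `[a + k%:R * d, a + k.+1%:R * d[%classic).
    rewrite completed_measure_itv /= lte_fin ltrD2l ltr_pM2r// ltr_nat ltnSn.
    by rewrite -EFinD /= -natr1; lra.
  apply/seteqP; split=> u /=.
    by move=> [Du] /(fib u Du).1 => /(_ kn); rewrite in_itv.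
  rewrite in_itv /= => /andP[ku uk].
  have Du : D u by rewrite /= in_itv /=; apply/andP; split; lra.
  by split=> //; apply/((fib u Du).1 kn); rewrite ku.
- rewrite (_ : _ `&` _ = set0) ?measure0//.
  apply/seteqP; split=> u //= [_] uk; move: nk; rewrite -uk /step_index.
  by rewrite ltnNge geq_minl.
- rewrite (_ : _ `&` _ = `[a + n%:R * d, a + n%:R * d]%classic).
    by rewrite completed_measure_itv /= ltxx.
  apply/seteqP; split=> u /=.
    by move=> [Du] /(fib u Du).2 => /(_ kn) ->; rewrite in_itv /= lexx.
  rewrite in_itv /= -eq_le => /eqP nu.
  have Du : D u.
    by rewrite /= in_itv /= -nu lexx andbT lerDl mulr_ge0// ltW.
  by split=> //; apply/((fib u Du).2 kn).
Qed.

(** Indexing by the cell number turns the simple integral of the step function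
    into a Riemann sum with left tags. *)
Lemma simple_integral_step {X : normedModType R[i]} (F : R -> X) : 0 < d ->
  simple_integral mu D (fun u => F (a + (step_index u)%:R * d)) =
  d%:C *: \sum_(k < n) F (a + k%:R * d).
Proof.
move=> d0; have fw := finite_map_step_index d0.
have mD : measurable D by exact: completed_measurable_itv.
have -> := simple_integral_comp mD (segment_measure_fin _ _)
  (fun k => F (a + k%:R * d)) fw.
set E := fset_set _.
pose G k := (fibre_mass mu D step_index k)%:C *: F (a + k%:R * d).
rewrite -[LHS]/(\sum_(k <- E) G k).
have G0 k : (n <= k)%N -> G k = 0.
  by move=> nk; rewrite /G step_index_mass// ltnNge nk scale0r.
have GE k : k \notin E -> G k = 0.
  move=> kE; rewrite /G /fibre_mass (_ : _ `&` _ = set0) ?measure0 ?scale0r//.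
  apply/seteqP; split=> u //= [_ uk].
  by move: kE; rewrite -uk (in_range_fset u fw).
rewrite scaler_sumr -(big_mkord xpredT (fun k => d%:C *: F (a + k%:R * d))).
transitivity (\sum_(k <- E | k \in index_iota 0 n) G k).
  rewrite [LHS](bigID (mem (index_iota 0 n)))/= [X in _ + X]big1 ?addr0// => k.
  by rewrite mem_index_iota /= -leqNgt => /G0.
transitivity (\sum_(k <- index_iota 0 n | k \in E) G k).
  rewrite -big_filter -[RHS]big_filter; apply: perm_big; apply: uniq_perm.
  - by rewrite filter_uniq.
  - by rewrite filter_uniq// iota_uniq.
  - by move=> k; rewrite !mem_filter andbC.
rewrite [LHS]big_mkcond big_nat [RHS]big_nat; apply: eq_bigr => k /= kn.
by case: ifPn => [_|/GE <-]; rewrite /G step_index_mass// kn.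
Qed.

End RiemannSums.

Definition riemann_sum {R : realType} {X : normedModType R[i]} (F : R -> X)
    (a h : R) (n : nat) : X :=
  (h / n%:R)%:C *: \sum_(k < n) F (a + k%:R * (h / n%:R)).

Section RiemannLimit.
Context {R : realType} {X : completeNormedModType R[i]}.
Variables (F : R -> X) (a h : R).
Hypotheses (h0 : 0 < h) (uF : unif_continuous_on `[a, a + h]%classic F).
Local Notation T := (caratheodory_type (wlength (@idfun R))^*%mu).
Local Notation mu := (@completed_lebesgue_measure R : {measure set T -> \bar R}).
Local Notation D := (`[a, a + h]%classic : set T).
Let mesh n : R := h / n.+1%:R.
Let step n (u : T) : X := F (a + (step_index a (mesh n) n.+1 u)%:R * mesh n).

Let mesh_gt0 n : 0 < mesh n. Proof. by rewrite divr_gt0. Qed.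

Let DE n : D = `[a, a + n.+1%:R * mesh n]%classic.
Proof. by rewrite /mesh mulrC divfK. Qed.

Let step_finite n : finite_map (step n).
Proof.
exact: (finite_map_comp (fun k => F (a + k%:R * mesh n))
  (finite_map_step_index _ _ (mesh_gt0 n))).
Qed.

Let step_cvg (e : R) : 0 < e ->
  \forall n \near \oo, forall u, D u -> rnorm (F u - step n u) <= e.
Proof.
move=> e0; have [d d0 Fd] := uF e0.
have : \forall n \near \oo, mesh n < d.
  near=> n; rewrite /mesh ltr_pdivrMr// -ltr_pdivrMl// mulrC.
  apply: (@lt_le_trans _ _ n%:R); last by rewrite ler_nat.
  near: n; exact: nbhs_infty_gtr.
apply: filterS => n nd u; rewrite (DE n) => Du.
have [Dk uk] := step_index_close (mesh_gt0 n) Du.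
apply: Fd; last exact: lt_trans uk nd.
- by move: Du; rewrite -DE.
- by move: Dk; rewrite -DE.
Unshelve. all: by end_near. Qed.

Lemma bochner_integrable_segment : bochner_integrable mu D F.
Proof.
exists step; apply: (uniform_bochner_approx _ _ step_finite step_cvg).
- exact: completed_measurable_itv.
- exact: segment_measure_fin.
Qed.

Lemma cvg_riemann_sum :
  riemann_sum F a h n.+1 @[n --> \oo] --> bochner_integral mu D F.
Proof.
have -> : (fun n => riemann_sum F a h n.+1) =
    (fun n => simple_integral mu D (step n)).
  by apply/funext => n; rewrite (DE n) (simple_integral_step a n.+1 F (mesh_gt0 n)).
apply: (cvg_simple_integral _ _ step_finite step_cvg).
- exact: completed_measurable_itv.
- exact: segment_measure_fin.
Qed.

End RiemannLimit.

(** * Integration by parts on Riemann sums *)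

Lemma rnorm_riemann_sum_le {R : realType} {X : normedModType R[i]}
    (F : R -> X) (a h M : R) (n : nat) : 0 < h ->
  (forall u, a <= u <= a + h -> rnorm (F u) <= M) ->
  rnorm (riemann_sum F a h n.+1) <= h * M.
Proof.
move=> h0 FM; rewrite /riemann_sum rnormZr ger0_norm ?divr_ge0 ?(ltW h0)//.
have -> : h * M = h / n.+1%:R * \sum_(k < n.+1) M.
  by rewrite sumr_const card_ord -[M *+ _]mulr_natl mulrA divfK// pnatr_eq0.
rewrite ler_wpM2l ?divr_ge0 ?(ltW h0)// (le_trans (rnorm_sum _ _))//.
apply: ler_sum => k _; apply: FM; apply/andP; split.
  by rewrite lerDl mulr_ge0// divr_ge0// ltW.
rewrite lerD2l mulrCA -[leRHS]mulr1 ler_wpM2l ?(ltW h0)//.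
by rewrite ler_pdivrMr ?ltr0n// mul1r ler_nat ltnW.
Qed.

Lemma riemann_sumB {R : realType} {X : normedModType R[i]}
    (F G : R -> X) (a h : R) (n : nat) :
  riemann_sum F a h n - riemann_sum G a h n =
  riemann_sum (fun s => F s - G s) a h n.
Proof. by rewrite /riemann_sum -scalerBr -sumrB. Qed.

Section ByParts.
Context {R : realType} {X : normedModType R[i]}.
Variables (e Q : R -> R[i]) (f : R -> X).
Variables (eps M K L q : R).

(** One block of the summation by parts.  With u i the grid points, the sum is
      sum e (u i) (f (u i) - f a) eta + (sum e (u i) eta) f a.
    The first term is small since f is nearly constant; in the second, e may be
    replaced by the increments of its approximate primitive Q, which telescope
    to Q b - Q a; and replacing (Q b) (f a) by (Q b) (f b) costs q eps. *)
Lemma riemann_block (a eta : R) (m : nat) : 0 <= eta ->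
  let b := a + m%:R * eta in
  (forall u, a <= u <= b -> cabs (e u) <= 1) ->
  (forall u v, a <= u -> u <= v -> v <= b ->
     cabs (Q v - Q u - (v - u)%:C * e u) <= (v - u) * (K + L * (v - u))) ->
  cabs (Q b) <= q ->
  (forall u, a <= u <= b -> rnorm (f u - f a) <= eps) ->
  rnorm (f a) <= M ->
  rnorm (eta%:C *: (\sum_(i < m) e (a + i%:R * eta) *: f (a + i%:R * eta)) -
         (Q b *: f b - Q a *: f a))
   <= m%:R * eta * eps + m%:R * eta * (K + L * eta) * M + q * eps.
Proof.
move=> eta0 b he hQ hq hf hM.
pose u i := a + i%:R * eta.
have uab (i : nat) : (i <= m)%N -> a <= u i <= b.
  move=> im; rewrite lerDl mulr_ge0//= lerD2l ler_wpM2r// ler_nat//.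
have abb : a <= b <= b by rewrite lexx andbT lerDl mulr_ge0.
have Sdec : eta%:C *: (\sum_(i < m) e (u i) *: f (u i)) =
    \sum_(i < m) (eta%:C * e (u i)) *: (f (u i) - f a) +
    \sum_(i < m) (eta%:C * e (u i) - (Q (u i.+1) - Q (u i))) *: f a +
    (Q b - Q a) *: f a.
  have -> : Q b - Q a = \sum_(i < m) (Q (u i.+1) - Q (u i)).
    rewrite -(big_mkord xpredT (fun i => Q (u i.+1) - Q (u i))).
    by rewrite telescope_sumr// /u mul0r addr0.
  rewrite -addrA scaler_suml -big_split/= scaler_sumr -big_split/=.
  apply: eq_bigr => i _.
  by rewrite -scalerDl subrK -scalerDr subrK scalerA.
have -> : eta%:C *: (\sum_(i < m) e (u i) *: f (u i)) - (Q b *: f b - Q a *: f a) =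
    \sum_(i < m) (eta%:C * e (u i)) *: (f (u i) - f a) +
    \sum_(i < m) (eta%:C * e (u i) - (Q (u i.+1) - Q (u i))) *: f a -
    Q b *: (f b - f a).
  rewrite Sdec -addrA; congr (_ + _).
  by rewrite scalerBr scalerBl !opprB addrA subrK.
rewrite (le_trans (rnormB _ _))// lerD//; last first.
  by rewrite rnormZ ler_pM ?cabs_ge0 ?rnorm_ge0// hf.
rewrite (le_trans (rnormD _ _))// lerD//.
- rewrite (le_trans (rnorm_sum _ _))//.
  have -> : m%:R * eta * eps = \sum_(i < m) eta * eps.
    by rewrite sumr_const card_ord -[RHS]mulr_natl mulrA.
  apply: ler_sum => i _; rewrite rnormZ cabsM cabsr ger0_norm//.
  have ui := uab i (ltnW (ltn_ord i)).
  rewrite ler_pM ?mulr_ge0 ?cabs_ge0 ?rnorm_ge0 ?hf//.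
  by rewrite -[leRHS]mulr1 ler_wpM2l// he.
- rewrite (le_trans (rnorm_sum _ _))//.
  have -> : m%:R * eta * (K + L * eta) * M = \sum_(i < m) eta * (K + L * eta) * M.
    by rewrite sumr_const card_ord -[RHS]mulr_natl !mulrA.
  apply: ler_sum => i _; rewrite rnormZ ler_pM ?cabs_ge0 ?rnorm_ge0//.
  have /andP[ui _] := uab i (ltnW (ltn_ord i)).
  have /andP[_ vi] := uab i.+1 (ltn_ord i).
  have uv : u i.+1 - u i = eta by rewrite /u -natr1; ring.
  rewrite -opprB /cabs normrN -/(cabs _).
  have := hQ (u i) (u i.+1) ui _ vi; rewrite uv; apply.
  by rewrite -subr_ge0 uv.
Qed.

(** Blocks of length h / N.+1 carry the variation eps of f, and each contains
    n.+1 grid points.  Letting n grow removes the term in L while N stays fixed,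
    so that the factor N.+1 can later be absorbed by a small q. *)
Lemma riemann_by_parts (t h : R) (N n : nat) : 0 < h ->
  (forall u, t <= u <= t + h -> cabs (e u) <= 1) ->
  (forall u v, t <= u -> u <= v -> v <= t + h ->
     cabs (Q v - Q u - (v - u)%:C * e u) <= (v - u) * (K + L * (v - u))) ->
  (forall u, t <= u <= t + h -> cabs (Q u) <= q) ->
  (forall u v, t <= u <= t + h -> t <= v <= t + h -> `|u - v| <= h / N.+1%:R ->
     rnorm (f u - f v) <= eps) ->
  (forall u, t <= u <= t + h -> rnorm (f u) <= M) ->
  rnorm (riemann_sum (fun u => e u *: f u) t h (N.+1 * n.+1) -
         (Q (t + h) *: f (t + h) - Q t *: f t))
   <= h * eps + h * (K + L * (h / (N.+1 * n.+1)%:R)) * M + N.+1%:R * q * eps.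
Proof.
move=> h0 he hQ hq hf hM; set eta := h / (N.+1 * n.+1)%:R.
have eta0 : 0 < eta by rewrite divr_gt0// ltr0n muln_gt0.
pose del : R := n.+1%:R * eta.
have Ndel : N.+1%:R * del = h.
  by rewrite /del /eta mulrA -natrM mulrC divfK// pnatr_eq0 muln_eq0.
have delE : del = h / N.+1%:R by rewrite -Ndel mulrC mulKf// pnatr_eq0.
have del0 : 0 < del by rewrite delE divr_gt0.
pose C := del * eps + del * (K + L * eta) * M + q * eps.
have main (j : nat) : (j <= N.+1)%N ->
  rnorm (eta%:C *: (\sum_(k < j * n.+1) e (t + k%:R * eta) *: f (t + k%:R * eta))
   - (Q (t + j%:R * del) *: f (t + j%:R * del) - Q t *: f t)) <= j%:R * C.
  elim: j => [_|j ih jN].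
    by rewrite mul0n big_ord0 scaler0 !mul0r addr0 subrr subr0 rnorm0.
  have {}ih := ih (ltnW jN).
  rewrite mulSnr big_split_ord /= scalerDr.
  set a := t + j%:R * del.
  have bE : t + j.+1%:R * del = a + del by rewrite /a -natr1; ring.
  rewrite bE; set S1 := eta%:C *: _ in ih *; set S2 := eta%:C *: _.
  have -> : S1 + S2 - (Q (a + del) *: f (a + del) - Q t *: f t) =
    (S1 - (Q a *: f a - Q t *: f t)) +
    (S2 - (Q (a + del) *: f (a + del) - Q a *: f a)).
    rewrite [RHS]addrACA -opprD; congr (_ - _).
    by rewrite [RHS]addrC addrA subrK.
  rewrite (le_trans (rnormD _ _))// -natr1 mulrDl mul1r lerD//.
  have -> : S2 = eta%:C *: \sum_(i < n.+1) e (a + i%:R * eta) *: f (a + i%:R * eta).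
    congr (_ *: _); apply: eq_bigr => i _.
    have -> // : t + (j * n.+1 + i)%:R * eta = a + i%:R * eta.
    by rewrite /a /del natrD natrM; ring.
  have jdel0 : 0 <= j%:R * del by rewrite mulr_ge0// ltW.
  have ta : t <= a by rewrite /a lerDl.
  have bh : a + del <= t + h.
    by rewrite -bE lerD2l -Ndel ler_pM2r// ler_nat.
  apply: riemann_block; rewrite ?(ltW eta0)//.
  - by move=> u /andP[au ub]; apply: he; rewrite (le_trans ta)//= (le_trans ub).
  - move=> u v au uv vb; apply: hQ => //; first exact: le_trans ta au.
    exact: le_trans vb bh.
  - by apply: hq; rewrite bh andbT (le_trans ta)// lerDl ltW.
  - move=> u /andP[au ub]; apply: hf.
    + by rewrite (le_trans ta)//= (le_trans ub).
    + by rewrite ta /= (le_trans _ bh)// lerDl ltW.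
    + by rewrite -delE ger0_norm ?subr_ge0// lerBlDl.
  - by apply: hM; rewrite ta /= (le_trans _ bh)// lerDl ltW.
have := main N.+1 (leqnn _); rewrite Ndel.
have -> // : N.+1%:R * C = h * eps + h * (K + L * eta) * M + N.+1%:R * q * eps.
by rewrite /C -Ndel; ring.
Qed.

End ByParts.

(** * The chirp and its approximate primitive *)

Section Chirp.
Context {R : realType}.
Implicit Types (x y z a b : R).

Lemma mean_value (f df : R -> R) a b : a <= b ->
  (forall x, a <= x <= b -> is_derive x 1 f (df x)) ->
  exists2 c, a <= c <= b & f b - f a = df c * (b - a).
Proof.
move=> ab fd.
have fd' x : x \in `[a, b] -> is_derive x 1 f (df x).
  by rewrite in_itv /=; exact: fd.
have cf : {within `[a, b], continuous f}.
  apply: derivable_within_continuous => x /fd' dfx.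
  exact: (@ex_derive _ _ _ _ _ _ _ dfx).
have fdo x : x \in `]a, b[ -> is_derive x 1 f (df x).
  by move=> /subset_itv_oo_cc; exact: fd'.
have [c cab ->] := MVT_segment ab fdo cf.
by exists c => //; move: cab; rewrite in_itv.
Qed.

Lemma cos_lipschitz a b : `|cos a - cos b| <= `|a - b|.
Proof.
wlog ab : a b / a <= b.
  move=> H; case: (leP a b) => [/H//|/ltW /H].
  by rewrite distrC [leRHS]distrC.
have [c _] := @mean_value cos (fun x => - sin x) a b ab (fun x _ => is_derive_cos x).
rewrite distrC [leRHS]distrC => ->; rewrite normrM normrN.
by rewrite -[leRHS]mul1r ler_wpM2r// sin_max.
Qed.

Lemma sin_lipschitz a b : `|sin a - sin b| <= `|a - b|.
Proof.
wlog ab : a b / a <= b.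
  move=> H; case: (leP a b) => [/H//|/ltW /H].
  by rewrite distrC [leRHS]distrC.
have [c _] := @mean_value sin cos a b ab (fun x _ => is_derive_sin x).
rewrite distrC [leRHS]distrC => ->; rewrite normrM.
by rewrite -[leRHS]mul1r ler_wpM2r// cos_max.
Qed.

Lemma cis_lipschitz a b : cabs (cis a - cis b) <= 2 * `|a - b|.
Proof.
rewrite (le_trans (cabs_le _))//= mulr_natl mulr2n lerD//.
- exact: cos_lipschitz.
- exact: sin_lipschitz.
Qed.

Variables (omega r : R).

Lemma powR_lipschitz S x y : 1 <= r -> 0 <= x -> x <= y -> y <= S ->
  `|y `^ r - x `^ r| <= r * S `^ (r - 1) * (y - x).
Proof.
move=> r1 x0 xy yS.
have r0 : 0 < r by lra.
have pmono c : 0 <= c -> c <= S -> c `^ (r - 1) <= S `^ (r - 1).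
  move=> c0 cS; apply: ge0_ler_powR; rewrite ?nnegrE//; first by lra.
  exact: le_trans cS.
move: x0; rewrite le_eqVlt => /predU1P[x0|x0].
- rewrite -x0 powR0 ?gt_eqF// !subr0 ger0_norm ?powR_ge0//.
  have y0 : 0 <= y by rewrite x0.
  have -> : y `^ r = y `^ (r - 1) * y.
    by rewrite mulrC mulr_powRB1.
  rewrite ler_wpM2r// (le_trans (pmono _ y0 yS))// ler_peMl ?powR_ge0//; lra.
- have [c /andP[xc cy] ->] := @mean_value (fun u => u `^ r)
    (fun u => r * u `^ (r - 1)) x y xy
    (fun u xu => is_derive1_powR r (lt_le_trans x0 (proj1 (andP xu)))).
  have c0 : 0 <= c := le_trans (ltW x0) xc.
  rewrite ger0_norm; last first.
    by rewrite !mulr_ge0 ?powR_ge0 ?subr_ge0// ltW.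
  rewrite ler_wpM2r ?subr_ge0// ler_wpM2l ?(ltW r0)//.
  by rewrite pmono// (le_trans cy).
Qed.

Lemma phase_lipschitz S x y : 2 <= r -> `|x| <= S -> `|y| <= S ->
  `|omega * `|x| `^ r - omega * `|y| `^ r| <=
  `|omega| * (r * S `^ (r - 1)) * `|x - y|.
Proof.
move=> r2 xS yS; rewrite -mulrBr normrM -mulrA ler_wpM2l//.
have C0 : 0 <= r * S `^ (r - 1) by rewrite mulr_ge0 ?powR_ge0//; lra.
apply: (@le_trans _ _ (r * S `^ (r - 1) * `| `|x| - `|y| |)); last first.
  by rewrite ler_wpM2l// ler_dist_dist.
case: (leP `|x| `|y|) => [xy|/ltW xy].
  rewrite distrC (distrC `|x|) (ger0_norm (_ : 0 <= `|y| - `|x|)) ?subr_ge0//.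
  by apply: powR_lipschitz => //; lra.
rewrite (ger0_norm (_ : 0 <= `|x| - `|y|)) ?subr_ge0//.
by apply: powR_lipschitz => //; lra.
Qed.

Local Notation kappa := ((omega * r)^-1).

(** The shift theta is there to treat sine (theta = 0) and minus cosine
    (theta = - pi / 2), the two components of the primitive, at once. *)
Lemma is_derive_phase_quotient (theta x : R) :
  omega != 0 -> 2 <= r -> 0 < x ->
  is_derive x 1 (fun u => sin (omega * u `^ r + theta) * (kappa * u `^ (1 - r)))
    (cos (omega * x `^ r + theta) +
     sin (omega * x `^ r + theta) * (kappa * ((1 - r) * x `^ (- r)))).
Proof.
move=> omega0 r2 x0.
have dpsi : is_derive x 1 (fun u => omega * u `^ r + theta)
    (omega * (r * x `^ (r - 1))).
  have h := is_deriveD (is_deriveZ omega (is_derive1_powR r x0))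
     (is_derive_cst theta x 1).
  by apply: (is_derive_eq h); rewrite addr0.
have dsin := @is_derive1_comp _ sin (fun u => omega * u `^ r + theta) _ _ _
  (is_derive_sin _) dpsi.
have dpow := is_deriveZ kappa (is_derive1_powR (1 - r) x0).
apply: (is_derive_eq (is_deriveM dsin dpow)).
have -> : 1 - r - 1 = - r by ring.
(* in the product rule the derivative omega r x^(r-1) of the phase cancels the
   amplitude, which leaves exactly the cosine *)
have xx : x `^ (1 - r) * x `^ (r - 1) = 1.
  by rewrite -opprB powRN mulVf// gt_eqF// powR_gt0.
have kk : kappa * (omega * r) = 1.
  by rewrite mulVf// mulf_neq0//; apply/eqP; lra.
rewrite /= /GRing.scale /=.
rewrite addrC; congr (_ + _).
transitivity (cos (omega * x `^ r + theta) *
  ((kappa * (omega * r)) * (x `^ (1 - r) * x `^ (r - 1)))); first by ring.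
by rewrite kk xx !mulr1.
Qed.

(** The mean value theorem gives the derivative at some c between x and y. It
    differs from the cosine at z by the defect of the primitive, of order T^-2,
    and by the variation of the cosine between c and z. *)
Lemma phase_quotient_increment (theta T S x y z : R) :
  omega != 0 -> 2 <= r -> 1 <= T -> T <= x -> x <= y -> y <= S -> x <= z <= y ->
  `|sin (omega * y `^ r + theta) * (kappa * y `^ (1 - r)) -
    sin (omega * x `^ r + theta) * (kappa * x `^ (1 - r)) -
    (y - x) * cos (omega * z `^ r + theta)| <=
  (y - x) * (`|omega|^-1 / T ^+ 2 + `|omega| * (r * S `^ (r - 1)) * (y - x)).
Proof.
move=> omega0 r2 T1 Tx xy yS /andP[xz zy].
have x0 : 0 < x by lra.
have r0 : 0 < r by lra.
have [c /andP[xc cy] ->] := mean_value xy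
  (fun u xu => is_derive_phase_quotient theta omega0 r2
    (lt_le_trans x0 (proj1 (andP xu)))).
rewrite mulrC -mulrBr normrM ger0_norm ?subr_ge0// ler_wpM2l ?subr_ge0//.
rewrite addrAC (le_trans (ler_normD _ _))// [leRHS]addrC lerD//; last first.
- have c0 : 0 < c by lra.
  rewrite normrM -[leRHS]mul1r ler_pM// ?sin_max//.
  rewrite mulrA normrM ler_pM//.
    rewrite normrM invfM normrM normfV -mulrA -[leRHS]mulr1 ler_wpM2l//.
    rewrite normfV (gtr0_norm r0) ler0_norm; last by lra.
    rewrite mulrC ler_pdivrMr//; lra.
  rewrite ger0_norm ?powR_ge0// powRN.
  rewrite lef_pV2 ?posrE ?exprn_gt0 ?powR_gt0//; last by lra.
  rewrite -powR_mulrn; last by lra.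
  apply: (@le_trans _ _ (c `^ 2)).
    by apply: ge0_ler_powR; rewrite ?nnegrE; lra.
  by apply: ler_powR => //; lra.
- apply: le_trans (cos_lipschitz _ _) _.
  rewrite opprD addrACA subrr addr0.
  have cn : `|c| = c by rewrite ger0_norm//; lra.
  have zn : `|z| = z by rewrite ger0_norm//; lra.
  have cS : `|c| <= S by lra.
  have zS : `|z| <= S by lra.
  have := phase_lipschitz r2 cS zS; rewrite cn zn => /le_trans; apply.
  rewrite ler_wpM2l//; last by rewrite ler_norml; apply/andP; split; lra.
  by rewrite !mulr_ge0 ?powR_ge0// ltW.
Qed.

(** The inverse of the derivative omega r sgn u |u|^(r-1) of the phase. *)
Definition primitive_amplitude (u : R) : R :=
  Num.sg u * (kappa * `|u| `^ (1 - r)).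

(** The chirp divided by i times the derivative of its phase. *)
Definition chirp_primitive (u : R) : R[i] :=
  (sin (omega * `|u| `^ r) * primitive_amplitude u) -i*
  (cos (omega * `|u| `^ r) * primitive_amplitude u).

Lemma chirp_primitiveE u : chirp_primitive u =
  (primitive_amplitude u)%:C * (0 -i* 1) * chirp omega r u.
Proof.
by rewrite /chirp_primitive /chirp; simpc; rewrite !(mulrC (primitive_amplitude u)).
Qed.

(** On the negative half-line everything is reflected; the increment from u to v
    becomes the one from - v to - u, and the cosine is taken at its right end,
    which is why the tag z was left free in phase_quotient_increment. *)
Lemma signed_quotient_increment (theta T S u v : R) :
  omega != 0 -> 2 <= r -> 1 <= T -> u <= v ->
  T <= u /\ v <= S \/ v <= - T /\ - S <= u ->
  `|sin (omega * `|v| `^ r + theta) * primitive_amplitude v -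
    sin (omega * `|u| `^ r + theta) * primitive_amplitude u -
    (v - u) * cos (omega * `|u| `^ r + theta)| <=
  (v - u) * (`|omega|^-1 / T ^+ 2 + `|omega| * (r * S `^ (r - 1)) * (v - u)).
Proof.
move=> omega0 r2 T1 uv [[Tu vS]|[vT Su]]; rewrite /primitive_amplitude.
- have u0 : 0 < u by lra.
  have v0 : 0 < v by lra.
  rewrite !gtr0_sg// !mul1r (gtr0_norm u0) (gtr0_norm v0).
  by apply: phase_quotient_increment => //; rewrite lexx uv.
- have u0 : u < 0 by lra.
  have v0 : v < 0 by lra.
  rewrite !ltr0_sg// !mulN1r (ltr0_norm u0) (ltr0_norm v0) !mulrN opprK.
  have := @phase_quotient_increment theta T S (- v) (- u) (- u) omega0 r2 T1.
  have -> : - u - - v = v - u by ring.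
  rewrite [X in _ -> `|X - _| <= _]addrC.
  by apply; try (apply/andP; split); lra.
Qed.

(** Both components of the complex increment are instances of the previous
    estimate; the disjunction says that [u, v] lies on one side of 0. *)
Lemma chirp_primitive_increment (T S u v : R) :
  omega != 0 -> 2 <= r -> 1 <= T -> u <= v ->
  T <= u /\ v <= S \/ v <= - T /\ - S <= u ->
  cabs (chirp_primitive v - chirp_primitive u - (v - u)%:C * chirp omega r u) <=
  (v - u) * (2 * (`|omega|^-1 / T ^+ 2) +
             2 * (`|omega| * (r * S `^ (r - 1))) * (v - u)).
Proof.
move=> omega0 r2 T1 uv uvTS.
have H theta := signed_quotient_increment theta omega0 r2 T1 uv uvTS.
have HR := H 0; have HI := H (- (pi / 2)).
rewrite !addr0 in HR; rewrite !sinBpihalf !cosBpihalf in HI.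
have -> : chirp_primitive v - chirp_primitive u - (v - u)%:C * chirp omega r u =
   (sin (omega * `|v| `^ r) * primitive_amplitude v -
    sin (omega * `|u| `^ r) * primitive_amplitude u -
    (v - u) * cos (omega * `|u| `^ r)) +i*
   (- cos (omega * `|v| `^ r) * primitive_amplitude v -
    - cos (omega * `|u| `^ r) * primitive_amplitude u -
    (v - u) * sin (omega * `|u| `^ r)).
  by apply/eqP; rewrite eq_complex /=; apply/andP; split; apply/eqP; ring.
apply: le_trans (cabs_le _) _.
rewrite /= (le_trans (lerD HR HI))// -mulrDr.
by rewrite ler_wpM2l ?subr_ge0//; lra.
Qed.


Lemma cabs_chirp u : cabs (chirp omega r u) = 1.
Proof. exact: cabs_cis. Qed.

Lemma chirp_lipschitz S u v : 2 <= r -> `|u| <= S -> `|v| <= S ->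
  cabs (chirp omega r u - chirp omega r v) <=
  2 * (`|omega| * (r * S `^ (r - 1))) * `|u - v|.
Proof.
move=> r2 uS vS; apply: le_trans (cis_lipschitz _ _) _.
by rewrite -mulrA ler_wpM2l// phase_lipschitz.
Qed.

Lemma cabs_chirp_primitive_le u : u != 0 ->
  cabs (chirp_primitive u) <= 2 * (`|kappa| * `|u| `^ (1 - r)).
Proof.
move=> u0; have aE : `|primitive_amplitude u| = `|kappa| * `|u| `^ (1 - r).
  by rewrite !normrM normr_sg u0 mul1r (ger0_norm (powR_ge0 _ _)).
apply: le_trans (cabs_le _) _; rewrite /= -aE mulr_natl mulr2n normrN !normrM.
by rewrite lerD// -[leRHS]mul1r ler_wpM2r ?sin_max ?cos_max.
Qed.
End Chirp.

(** * Integrals over a moving window *)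

Lemma rnorm_lim_le {R : realType} {X : normedModType R[i]}
    (u : nat -> X) (l c : X) (b : R) : u n @[n --> \oo] --> l ->
  (forall e, 0 < e -> forall n0, exists2 n, (n0 <= n)%N & rnorm (u n - c) <= b + e) ->
  rnorm (l - c) <= b.
Proof.
move=> /cvg_rnormP ul ub; apply/ler_addgt0Pr => e e0.
have e20 : 0 < e / 2 by lra.
have [n0 _ un0] := ul _ e20; have [n n0n unb] := ub _ e20 n0.
have lu : rnorm (l - u n) < e / 2 by exact: un0.
by have := rnorm_dist3 (u n) l c; lra.
Qed.

Lemma powR_decay {R : realType} (r T x : R) : 2 <= r -> 1 <= T -> T <= x ->
  x `^ (1 - r) <= T^-1.
Proof.
move=> r2 T1 Tx; have -> : 1 - r = - (r - 1) by ring.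
rewrite powRN lef_pV2 ?posrE ?powR_gt0//; [|lra|lra].
have x0 : 0 <= x by lra.
apply: (le_trans Tx); rewrite -[leLHS](powRr1 x0).
by apply: ler_powR; lra.
Qed.

Section WindowIntegral.
Context {R : realType} {X : completeNormedModType R[i]}.
Variables (F : R -> X) (h : R).
Hypothesis h0 : 0 < h.
Implicit Types (D : set R) (x y t : R).

Definition window_integral t : X :=
  bochner_integral completed_lebesgue_measure `[0, h]%classic
    (fun s => F (t + s)).

Lemma cvg_window_integral D t :
  (forall s, t <= s <= t + h -> D s) -> unif_continuous_on D F ->
  riemann_sum (fun s => F (t + s)) 0 h n.+1 @[n --> \oo] --> window_integral t.
Proof.
move=> tD uF; rewrite /window_integral -[X in `[0, X]%classic](add0r h).
apply: cvg_riemann_sum => // e e0; have [d d0 Fd] := uF e e0.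
have inD s : `[0, 0 + h]%classic s -> D (t + s).
  by rewrite /= in_itv /= add0r => /andP[s0 sh]; apply: tD; rewrite lerDl s0 lerD2l.
exists d => // x y /inD Dx /inD Dy xy; apply: Fd => //.
by rewrite opprD addrACA subrr add0r.
Qed.

Lemma window_integral_dist D x y (e : R) :
  (forall s, x <= s <= x + h -> D s) -> (forall s, y <= s <= y + h -> D s) ->
  unif_continuous_on D F ->
  (forall s, 0 <= s <= h -> rnorm (F (x + s) - F (y + s)) <= e) ->
  rnorm (window_integral x - window_integral y) <= h * e.
Proof.
move=> xD yD uF Fe.
have cx := cvg_window_integral xD uF; have cy := cvg_window_integral yD uF.
rewrite -[_ - _]subr0; apply: (rnorm_lim_le (cvgB cx cy)) => e' e'0 n0.
exists n0 => //; rewrite subr0 riemann_sumB.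
apply: (@le_trans _ _ (h * e)); last by rewrite lerDl ltW.
apply: rnorm_riemann_sum_le => // u; rewrite add0r; exact: Fe.
Qed.

Lemma window_integral_bound D x (M : R) :
  (forall s, x <= s <= x + h -> D s) -> unif_continuous_on D F ->
  (forall s, x <= s <= x + h -> rnorm (F s) <= M) ->
  rnorm (window_integral x) <= h * M.
Proof.
move=> xD uF FM; rewrite -[window_integral x]subr0.
apply: (rnorm_lim_le (cvg_window_integral xD uF)) => e' e'0 n0.
exists n0 => //; rewrite subr0.
apply: (@le_trans _ _ (h * M)); last by rewrite lerDl ltW.
apply: rnorm_riemann_sum_le => // u; rewrite add0r => /andP[u0 uh].
by apply: FM; rewrite lerDl u0 lerD2l.
Qed.

End WindowIntegral.

Definition chirped {R : realType} {X : normedModType R[i]} (omega r : R)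
  (f : R -> X) (u : R) : X := chirp omega r u *: f u.

Definition chirp_boundary {R : realType} {X : normedModType R[i]} (omega r : R)
  (f : R -> X) (u : R) : X := chirp_primitive omega r u *: f u.

Section ChirpWindow.
Context {R : realType} {X : completeNormedModType R[i]}.
Variables (J : set R) (f : R -> X) (omega r h : R).
Hypotheses (Jup : forall x y, J x -> x <= y -> J y).
Hypothesis uf : unif_continuous_on J f.

Local Notation F := (chirped omega r f).
Local Notation P := (chirp_boundary omega r f).
Local Notation ball S := (J `&` [set x | `|x| <= S]).

Lemma bounded_on_ball S : exists2 M, 0 <= M & forall x, ball S x -> rnorm (f x) <= M.
Proof.
have [C C0 fC] := linear_growth Jup uf.
exists (C * (1 + `|S|)); first by rewrite mulr_ge0// addr_ge0.
move=> x [Jx /= xS]; rewrite (le_trans (fC x Jx))// ler_wpM2l// lerD2l.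
by rewrite (le_trans xS)// ler_norm.
Qed.

Lemma unif_continuous_chirp_ball (S : R) : 2 <= r ->
  unif_continuous_on (ball S) F.
Proof.
move=> r2; have [M M0 fM] := bounded_on_ball S.
apply: (@unif_continuous_on_scale _ _ _ _ _
  (2 * (`|omega| * (r * S `^ (r - 1)))) M) => //.
- by rewrite !mulr_ge0 ?powR_ge0//; lra.
- by move=> x _; rewrite cabs_chirp.
- by move=> x y [_ xS] [_ yS]; exact: chirp_lipschitz.
- by apply: unif_continuous_on_sub uf => x [].
Qed.

Lemma window_in_ball S t : 0 < h -> J t -> `|t| <= S ->
  forall s, t <= s <= t + h -> ball (S + h) s.
Proof.
move=> h0 Jt tS s /andP[ts st]; split; first exact: Jup Jt ts.
by move: tS; rewrite /= !ler_norml => /andP[tS1 tS2]; apply/andP; split; lra.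
Qed.

(** The window [t, t + h] stays at distance at least T = |t| - h from 0, so the
    primitive is of size O(1 / T) and its defect O(1 / T^2) on it. *)
Lemma chirp_window_by_parts (t T eps : R) (C : R) (N : nat) :
  omega != 0 -> 2 <= r -> 0 < h -> J t -> 1 <= T -> T = `|t| - h ->
  0 <= C -> (forall x, J x -> rnorm (f x) <= C * (1 + `|x|)) ->
  (forall x y, J x -> J y -> `|x - y| <= h / N.+1%:R -> rnorm (f x - f y) <= eps) ->
  rnorm (window_integral F h t - (P (t + h) - P t)) <=
  h * eps + h * (2 * (`|omega|^-1 / T ^+ 2)) * (C * (1 + (`|t| + h))) +
  N.+1%:R * (2 * (`|(omega * r)^-1| / T)) * eps.
Proof.
move=> omega0 r2 h0 Jt T1 TE C0 fC feps.
have tbox s : t <= s <= t + h -> J s /\ T <= `|s| <= `|t| + h.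
  move=> /andP[ts st]; split; first exact: Jup Jt ts.
  have := ler_dist_dist s t; rewrite (ger0_norm (_ : 0 <= s - t)) ?subr_ge0//.
  by rewrite TE ler_norml => /andP[d1 d2]; apply/andP; split; lra.
apply: rnorm_lim_le (cvg_window_integral h0 (window_in_ball h0 Jt (lexx `|t|))
  (unif_continuous_chirp_ball _ r2)) _ => e e0 n0.
pose L := 2 * (`|omega| * (r * (`|t| + h) `^ (r - 1))).
have L0 : 0 <= L by rewrite !mulr_ge0 ?powR_ge0//; lra.
pose M := C * (1 + (`|t| + h)).
have M0 : 0 <= M by rewrite mulr_ge0// !addr_ge0// ltW.
have [n1 n1e] : exists n1 : nat, h * (L * h) * M <= e * n1%:R.
  exists (Num.truncn (h * (L * h) * M / e)).+1.
  have x0 : 0 <= h * (L * h) * M / e.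
    have h1 := ltW h0; apply: divr_ge0; last exact: ltW.
    by rewrite mulr_ge0// mulr_ge0// mulr_ge0.
  have /andP[_ /ltW] := truncn_itv x0.
  by rewrite ler_pdivrMr// [X in _ <= X -> _]mulrC.
(* riemann_by_parts only speaks of numbers of points divisible by N.+1 *)
pose n := maxn n0 n1; exists (N.+1 * n.+1).-1.
  have : (n.+1 <= N.+1 * n.+1)%N by rewrite leq_pmull.
  rewrite /n; case: (_ * _)%N => // k; rewrite ltnS.
  by apply: leq_trans; exact: leq_maxl.
rewrite prednK ?muln_gt0//.
have -> : riemann_sum (fun s => F (t + s)) 0 h (N.+1 * n.+1) =
    riemann_sum F t h (N.+1 * n.+1).
  by rewrite /riemann_sum; congr (_ *: _); apply: eq_bigr => k _; rewrite add0r.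
have m0 : 0 < (N.+1 * n.+1)%:R :> R by rewrite ltr0n muln_gt0.
have small : h * (L * (h / (N.+1 * n.+1)%:R)) * M <= e.
  have -> : h * (L * (h / (N.+1 * n.+1)%:R)) * M =
    h * (L * h) * M / (N.+1 * n.+1)%:R by ring.
  rewrite ler_pdivrMr// (le_trans n1e)// ler_wpM2l ?(ltW e0)// ler_nat.
  rewrite (@leq_trans n.+1) ?leq_pmull//.
  by rewrite /n ltnW// ltnS leq_maxr.
have := @riemann_by_parts _ _ (chirp omega r) (chirp_primitive omega r) f
  eps M (2 * (`|omega|^-1 / T ^+ 2)) L (2 * (`|(omega * r)^-1| / T))
  t h N n h0.
move=> H; apply: (le_trans (H _ _ _ _ _)).
- by move=> u _; rewrite cabs_chirp.
- move=> u v tu uv vt; apply: chirp_primitive_increment => //.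
  case: (leP 0 t) => t0; [left|right]; move: TE.
    by rewrite (ger0_norm t0) => TE; split; lra.
  by rewrite (ltr0_norm t0) => TE; split; lra.
- move=> u /tbox[_ /andP[Tu _]].
  have u0 : u != 0 by rewrite -normr_gt0; lra.
  apply: (le_trans (cabs_chirp_primitive_le omega r u0)).
  by rewrite ler_wpM2l// ler_wpM2l// powR_decay.
- by move=> u v /tbox[Ju _] /tbox[Jv _]; exact: feps.
- move=> u /tbox[Ju /andP[_ uS]]; apply: le_trans (fC u Ju) _.
  by rewrite ler_wpM2l// lerD2l.
- have -> : h * (2 * (`|omega|^-1 / T ^+ 2) + L * (h / (N.+1 * n.+1)%:R)) * M =
    h * (2 * (`|omega|^-1 / T ^+ 2)) * M + h * (L * (h / (N.+1 * n.+1)%:R)) * M.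
    by ring.
  rewrite -/M; move: small; move: (_ * M) (_ * M) (_ * eps) (_ * eps) => *; lra.
Qed.
End ChirpWindow.

(** * The mean divided by the chirp *)

Section Quadratic.
Context {R : realType} {X : normedModType R[i]}.
Variables (J : set R) (f : R -> X).
Hypotheses (Jup : forall x y, J x -> x <= y -> J y).
Hypothesis uf : unif_continuous_on J f.

(** f x / x - f y / y = (f x - f y) / x + f y (y - x) / (x y), where the linear
    growth of f y is compensated by 1 / y. *)
Lemma unif_continuous_divr (C : R) : 0 <= C ->
  (forall x, J x -> rnorm (f x) <= C * (1 + `|x|)) ->
  unif_continuous_on (J `&` [set x | 1 <= `|x|]) (fun u => (u^-1)%:C *: f u).
Proof.
move=> C0 fC e e0; have e20 : 0 < e / 2 by lra.
have [d d0 fd] := uf e20; have C20 : 0 <= 2 * C by rewrite mulr_ge0.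
exists (Num.min d (e / 2 / (2 * C + 1))).
  by rewrite lt_min d0 divr_gt0// ltr_wpDl.
move=> x y [Jx /= x1] [Jy /= y1]; rewrite lt_min => /andP[xyd xye].
have x0 : x != 0 by rewrite -normr_gt0; lra.
have y0 : y != 0 by rewrite -normr_gt0; lra.
have -> : (x^-1)%:C *: f x - (y^-1)%:C *: f y =
    (x^-1)%:C *: (f x - f y) + (x^-1 - y^-1)%:C *: f y.
  by rewrite rmorphB /= scalerBr scalerBl addrA subrK.
have -> : e = e / 2 + e / 2 by lra.
rewrite (le_trans (rnormD _ _))// !rnormZr lerD//.
- rewrite -[leRHS]mul1r ler_pM ?rnorm_ge0 ?fd// normfV invf_le1//; lra.
- have -> : x^-1 - y^-1 = (y - x) / (x * y) by field; rewrite ?x0 ?y0.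
  apply: (@le_trans _ _ (`|x - y| * (2 * C))); last first.
    move: xye; rewrite ltr_pdivlMr ?ltr_wpDl// => /ltW; apply: le_trans.
    by rewrite ler_wpM2l// lerDl.
  rewrite distrC normrM -mulrA ler_wpM2l// normfV normrM invfM -mulrA.
  rewrite ler_pdivrMl; last by lra.
  rewrite ler_pdivrMl; last by lra.
  apply: le_trans (fC y Jy) _.
  have : 0 <= C * (`|y| - 1) by rewrite mulr_ge0// subr_ge0.
  have : 0 <= (`|x| - 1) * (C * `|y|) by rewrite mulr_ge0 ?subr_ge0// mulr_ge0.
  lra.
Qed.

Lemma rnorm_divr_le (C u : R) : 0 <= C ->
  (forall x, J x -> rnorm (f x) <= C * (1 + `|x|)) ->
  J u -> 1 <= `|u| -> rnorm ((u^-1)%:C *: f u) <= 2 * C.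
Proof.
move=> C0 fC Ju u1; rewrite rnormZr normfV ler_pdivrMl; last by lra.
apply: le_trans (fC u Ju) _.
have : 0 <= C * (`|u| - 1) by rewrite mulr_ge0// subr_ge0.
lra.
Qed.

End Quadratic.

Section DemodulatedMean.
Context {R : realType} {X : completeNormedModType R[i]}.
Variables (J : set R) (f : R -> X) (omega r h : R).
Hypotheses (Jup : forall x y, J x -> x <= y -> J y).
Hypothesis uf : unif_continuous_on J f.
Local Notation F := (chirped omega r f).
Local Notation P := (chirp_boundary omega r f).

Definition demodulated_mean t : X :=
  chirp (- omega) r t *: ((h^-1)%:C *: window_integral F h t).

Definition demodulated_boundary t : X :=
  chirp (- omega) r t *: ((h^-1)%:C *: (P (t + h) - P t)).

(** The number N of blocks is fixed by the modulus of continuity of f before t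
    grows; the remaining terms are then at most B / T.  In the middle term one
    power of 1 / T is spent on the linear growth of f. *)
Lemma demodulated_mean_far (e : R) : omega != 0 -> 2 <= r -> 0 < h -> 0 < e ->
  exists T : R, forall t, J t -> T <= `|t| ->
    rnorm (demodulated_mean t - demodulated_boundary t) <= e.
Proof.
move=> omega0 r2 h0 e0; have [C C0 fC] := linear_growth Jup uf.
have e20 : 0 < e / 2 by lra.
have [d d0 fd] := uf e20.
have [N Nd] : exists N : nat, h / N.+1%:R < d.
  have hd0 : 0 <= h / d by rewrite divr_ge0// ltW.
  exists (Num.truncn (h / d)); have /andP[_] := truncn_itv hd0.
  by rewrite ltr_pdivrMr// ltr_pdivrMr// mulrC.
pose a := `|omega|^-1; have a0 : 0 <= a by rewrite invr_ge0.
pose k := `|(omega * r)^-1|; have k0 : 0 <= k by rewrite normr_ge0.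
pose B := h * (2 * a) * (C * (2 + 2 * h)) + N.+1%:R * (2 * k) * (e / 2).
have B0 : 0 <= B.
  have h1 := ltW h0; have e1 := ltW e20.
  by rewrite addr_ge0// mulr_ge0// mulr_ge0//; lra.
have he0 : 0 < h * (e / 2) by rewrite mulr_gt0.
exists (h + 1 + B / (h * (e / 2))) => t Jt Tt.
pose T := `|t| - h.
have BT : 0 <= B / (h * (e / 2)) by rewrite divr_ge0// ltW.
have T1 : 1 <= T by rewrite /T; lra.
have T0 : 0 < T by lra.
have fe x y : J x -> J y -> `|x - y| <= h / N.+1%:R -> rnorm (f x - f y) <= e / 2.
  by move=> Jx Jy xy; apply: fd => //; exact: le_lt_trans xy Nd.
have H := chirp_window_by_parts Jup uf omega0 r2 h0 Jt T1 erefl C0 fC fe.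
rewrite -!scalerBr rnormZ cabs_chirp mul1r rnormZr ger0_norm ?invr_ge0 ?(ltW h0)//.
rewrite ler_pdivrMl//; apply: (le_trans H); rewrite -/a -/k.
have b1 : h * (2 * (a / T ^+ 2)) * (C * (1 + (`|t| + h))) <=
    h * (2 * a) * (C * (2 + 2 * h)) / T.
  have -> : h * (2 * a) * (C * (2 + 2 * h)) / T =
      h * (2 * (a / T ^+ 2)) * (C * ((2 + 2 * h) * T)).
    by field; rewrite gt_eqF.
  rewrite ler_wpM2l ?mulr_ge0 ?invr_ge0 ?exprn_ge0 ?(ltW h0) ?(ltW T0)//.
  rewrite ler_wpM2l//.
  have -> : `|t| = T + h by rewrite /T subrK.
  have : 0 <= h * (T - 1) by rewrite mulr_ge0 ?(ltW h0)//; lra.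
  lra.
have b2 : N.+1%:R * (2 * (k / T)) * (e / 2) = N.+1%:R * (2 * k) * (e / 2) / T by ring.
have b3 : B / T <= h * (e / 2).
  by rewrite ler_pdivrMr// mulrC -ler_pdivrMr//; rewrite /T; lra.
rewrite b2; move: b1 b3; rewrite /B mulrDl => b1 b3; lra.
Qed.

Lemma chirp_demodulate t : chirp (- omega) r t * chirp omega r t = 1.
Proof. by rewrite -[_ * _]cisD mulNr addNr cis0. Qed.

(** For |u| >= 1, |P u| is at most a constant times |u|^(1-r) |u| = |u|^(2-r). *)
Lemma demodulated_boundary_vanish (e : R) : omega != 0 -> 2 < r -> 0 < h -> 0 < e ->
  exists T : R, forall t, J t -> T <= `|t| -> rnorm (demodulated_boundary t) <= e.
Proof.
move=> omega0 r2 h0 e0; have [C C0 fC] := linear_growth Jup uf.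
pose k := `|(omega * r)^-1|; have k0 : 0 <= k by rewrite normr_ge0.
have c0 : 0 <= 4 * k * C by rewrite !mulr_ge0.
pose eta := h * e / 2 / (4 * k * C + 1).
have eta0 : 0 < eta by rewrite !divr_gt0// ?mulr_gt0// ltr_wpDl.
pose T1 := Num.max 1 ((eta^-1) `^ ((r - 2)^-1)).
have PT u : J u -> T1 <= `|u| -> rnorm (P u) <= h * e / 2.
  move=> Ju; rewrite ge_max => /andP[u1 uT].
  have u0 : u != 0 by rewrite -normr_gt0; lra.
  have ueta : `|u| `^ (2 - r) <= eta.
    have -> : 2 - r = - (r - 2) by ring.
    rewrite powRN -[leRHS]invrK lef_pV2 ?posrE ?invr_gt0 ?powR_gt0//; last by lra.
    apply: (@le_trans _ _ (((eta^-1) `^ ((r - 2)^-1)) `^ (r - 2))).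
      by rewrite -powRrM mulVf ?powRr1 ?invr_ge0 ?(ltW eta0)//; apply/eqP; lra.
    by apply: ge0_ler_powR; rewrite ?nnegrE ?powR_ge0//; lra.
  rewrite /chirp_boundary rnormZ.
  apply: (@le_trans _ _ (2 * (k * `|u| `^ (1 - r)) * (C * (2 * `|u|)))).
    apply: ler_pM; rewrite ?cabs_ge0 ?rnorm_ge0 ?cabs_chirp_primitive_le//.
    by rewrite (le_trans (fC u Ju))// ler_wpM2l//; lra.
  have -> : 2 * (k * `|u| `^ (1 - r)) * (C * (2 * `|u|)) =
      4 * k * C * (`|u| * `|u| `^ (1 - r)) by ring.
  have -> : `|u| * `|u| `^ (1 - r) = `|u| `^ (2 - r).
    have -> : 2 - r = 1 + (1 - r) by ring.
    by rewrite [RHS]powRD ?powRr1// normr_eq0 u0 implybT.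
  apply: (@le_trans _ _ (4 * k * C * eta)); first by rewrite ler_wpM2l.
  rewrite /eta mulrA ler_pdivrMr ?ltr_wpDl// mulrC ler_wpM2l//; last by lra.
  by rewrite divr_ge0// mulr_ge0// ltW.
exists (T1 + h) => t Jt tT; rewrite rnormZ cabs_chirp mul1r.
rewrite rnormZr ger0_norm ?invr_ge0 ?(ltW h0)// ler_pdivrMl//.
have tT1 : T1 <= `|t| by lra.
have Jth : J (t + h) by apply: Jup Jt _; rewrite lerDl ltW.
have thT1 : T1 <= `|t + h|.
  have := ler_normB (t + h) h; rewrite addrK (gtr0_norm h0); lra.
by have := rnormB (P (t + h)) (P t); have := PT _ Jt tT1; have := PT _ Jth thT1; lra.
Qed.

(** For r = 2 the boundary terms after division by the chirp, up to a constant: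
    the phase omega ((t + h)^2 - t^2) is affine in t. *)
Definition quadratic_boundary t : X :=
  cis (omega * (2 * h * t + h ^+ 2)) *: (((t + h)^-1)%:C *: f (t + h)) -
  (t^-1)%:C *: f t.

Lemma demodulated_boundary_quadraticE t : r = 2 -> t != 0 -> t + h != 0 ->
  demodulated_boundary t =
  ((h^-1)%:C * ((omega * 2)^-1)%:C * (0 -i* 1)) *: quadratic_boundary t.
Proof.
move=> r2 t0 th0.
have amp u : u != 0 -> primitive_amplitude omega r u = (omega * 2)^-1 * u^-1.
  move=> u0; rewrite /primitive_amplitude r2 mulrCA; congr (_ * _).
  have -> : 1 - 2 = - 1 :> R by ring.
  rewrite powR_inv1//; move: u0; case: (ltrgtP u 0) => // u0 _.
  - by rewrite ltr0_sg// ltr0_norm// mulN1r invrN opprK.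
  - by rewrite gtr0_sg// gtr0_norm// mul1r.
have PE u : u != 0 -> P u =
    ((omega * 2)^-1)%:C * (0 -i* 1) *: (chirp omega r u *: ((u^-1)%:C *: f u)).
  move=> u0; rewrite /chirp_boundary chirp_primitiveE (amp u u0) !scalerA.
  by congr (_ *: _); rewrite rmorphM /=; ring.
have phase : chirp (- omega) r t * chirp omega r (t + h) =
    cis (omega * (2 * h * t + h ^+ 2)).
  rewrite -[_ * _]cisD; congr cis; rewrite r2 !powR_mulrn// !real_normK ?num_real//.
  by ring.
rewrite /demodulated_boundary /quadratic_boundary !PE// -phase !scalerBr !scalerA.
congr (_ *: _ - _ *: _); first by ring.
by rewrite -[RHS]mul1r -(chirp_demodulate t); ring.
Qed.

Lemma quadratic_boundary_far (C : R) : 0 < h -> 0 <= C ->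
  (forall x, J x -> rnorm (f x) <= C * (1 + `|x|)) ->
  unif_continuous_on (J `&` [set t | h + 1 <= `|t|]) quadratic_boundary /\
  forall t, J t -> h + 1 <= `|t| -> rnorm (quadratic_boundary t) <= 4 * C.
Proof.
move=> h0 C0 fC.
have C20 : 0 <= 2 * C by rewrite mulr_ge0.
have Jh t : J t -> J (t + h) by move=> Jt; apply: Jup Jt _; rewrite lerDl ltW.
have th1 t : h + 1 <= `|t| -> 1 <= `|t + h|.
  by move=> tT; have := ler_normB (t + h) h; rewrite addrK (gtr0_norm h0); lra.
have t1 (t : R) : h + 1 <= `|t| -> 1 <= `|t| by move=> tT; lra.
have ug := unif_continuous_divr uf C0 fC; split; last first.
  move=> t Jt tT; rewrite (le_trans (rnormB _ _))// rnormZ cabs_cis mul1r.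
  have := rnorm_divr_le C0 fC (Jh t Jt) (th1 t tT).
  by have := rnorm_divr_le C0 fC Jt (t1 t tT); lra.
apply: unif_continuous_onB; last first.
  by apply: unif_continuous_on_sub ug => t [Jt /= tT]; split=> //=; exact: t1.
apply: (@unif_continuous_on_scale _ _ _ _ _ (2 * (`|omega| * (2 * h))) (2 * C)) => //.
- by rewrite !mulr_ge0// ltW.
- by move=> t _; rewrite cabs_cis.
- move=> x y _ _; apply: le_trans (cis_lipschitz _ _) _.
  have -> : omega * (2 * h * x + h ^+ 2) - omega * (2 * h * y + h ^+ 2) =
    omega * (2 * h) * (x - y) by ring.
  by rewrite !normrM -!mulrA (gtr0_norm h0) (ger0_norm (ler0n R 2)).
- by move=> t [Jt /= tT]; exact: rnorm_divr_le C0 fC (Jh t Jt) (th1 t tT).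
- move=> e e0; have [d d0 gd] := ug e e0; exists d => // x y [Jx /= xT] [Jy /= yT] xy.
  apply: gd; [by split; [exact: Jh|exact: th1]|by split; [exact: Jh|exact: th1]|].
  by have -> : x + h - (y + h) = x - y by ring.
Qed.

Lemma unif_continuous_far_quadratic : r = 2 -> 0 < h ->
  unif_continuous_far J demodulated_boundary /\
  exists T M, forall t, J t -> T <= `|t| ->
    rnorm (demodulated_boundary t) <= M.
Proof.
move=> r2 h0; have [C C0 fC] := linear_growth Jup uf.
have [uq bq] := quadratic_boundary_far h0 C0 fC.
pose c := (h^-1)%:C * ((omega * 2)^-1)%:C * (0 -i* 1) : R[i].
have dbE t : h + 1 <= `|t| -> demodulated_boundary t = c *: quadratic_boundary t.
  move=> tT; apply: demodulated_boundary_quadraticE => //.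
    by rewrite -normr_gt0; lra.
  rewrite -normr_gt0.
  by have := ler_normB (t + h) h; rewrite addrK (gtr0_norm h0); lra.
split.
- move=> e e0; have c1 : 0 < cabs c + 1 by rewrite ltr_wpDl// cabs_ge0.
  have [d d0 qd] := uq _ (divr_gt0 e0 c1).
  exists (h + 1); exists d => // x y Jx Jy xT yT xy.
  rewrite !dbE// -scalerBr rnormZ.
  apply: (@le_trans _ _ ((cabs c + 1) * (e / (cabs c + 1)))); last first.
    by rewrite mulrC divfK// gt_eqF.
  by apply: ler_pM; rewrite ?cabs_ge0 ?rnorm_ge0 ?lerDl//; apply: qd.
- exists (h + 1); exists (cabs c * (4 * C)) => t Jt tT.
  by rewrite dbE// rnormZ ler_wpM2l ?cabs_ge0// bq.
Qed.

Lemma unif_continuous_far_boundary : omega != 0 -> 2 <= r -> 0 < h ->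
  unif_continuous_far J demodulated_boundary /\
  exists T M, forall t, J t -> T <= `|t| ->
    rnorm (demodulated_boundary t) <= M.
Proof.
move=> omega0; rewrite le_eqVlt => /predU1P[r2|r2] h0.
  exact: unif_continuous_far_quadratic.
(* a function that vanishes at infinity is uniformly continuous there, however
   fast it oscillates *)
have vanish := demodulated_boundary_vanish omega0 r2 h0; split.
- move=> e e0; have [|T fT] := vanish (e / 2); first by lra.
  exists T; exists 1 => // x y Jx Jy xT yT _.
  have := rnormB (demodulated_boundary x) (demodulated_boundary y).
  by have := fT x Jx xT; have := fT y Jy yT; lra.
- by have [T fT] := vanish 1 ltr01; exists T, 1.
Qed.

End DemodulatedMean.

Section MeanIsDemodulatedBUC.
Context {R : realType} {X : completeNormedModType R[i]}.
Variables (J : set R) (f : R -> X) (omega r h : R).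
Hypotheses (Jup : forall x y, J x -> x <= y -> J y).
Hypothesis uf : unif_continuous_on J f.
Local Notation F := (chirped omega r f).
Local Notation ball S := (J `&` [set x | `|x| <= S]).

Lemma window_integral_ball (S : R) : 2 <= r -> 0 < h ->
  unif_continuous_on (ball S) (window_integral F h) /\
  exists2 M, 0 <= M & forall t, ball S t -> rnorm (window_integral F h t) <= M.
Proof.
move=> r2 h0; have uF := unif_continuous_chirp_ball omega Jup uf (S + h) r2.
have inb t : ball S t -> forall s, t <= s <= t + h -> ball (S + h) s.
  by move=> [Jt tS]; exact: window_in_ball.
split.
- move=> e e0; have [d d0 Fd] := uF _ (divr_gt0 e0 h0).
  exists d => // x y bx yb xy.
  have -> : e = h * (e / h) by rewrite mulrC divfK// gt_eqF.
  apply: (window_integral_dist h0 (inb x bx) (inb y yb) uF) => s /andP[s0 sh].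
  have sin z : z <= z + s <= z + h by rewrite lerDl s0 lerD2l.
  apply: Fd; [exact: inb bx _ (sin x)|exact: inb yb _ (sin y)|].
  by rewrite opprD addrACA subrr addr0.
- have [M M0 fM] := bounded_on_ball Jup uf (S + h).
  exists (h * M); first by rewrite mulr_ge0// ltW.
  move=> t bt; apply: (window_integral_bound h0 (inb t bt) uF) => s ts.
  by rewrite /chirped rnormZ cabs_chirp mul1r; apply: fM; exact: inb bt _ ts.
Qed.

Lemma demodulated_mean_ball (S : R) : 2 <= r -> 0 < h ->
  unif_continuous_on (ball S) (demodulated_mean f omega r h) /\
  exists M, forall t, ball S t -> rnorm (demodulated_mean f omega r h t) <= M.
Proof.
move=> r2 h0; have [uI [M M0 IM]] := window_integral_ball S r2 h0.
have hV0 : 0 <= h^-1 by rewrite invr_ge0 ltW.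
split; last first.
  exists (h^-1 * M) => t bt; rewrite rnormZ cabs_chirp mul1r rnormZr ger0_norm//.
  by rewrite ler_wpM2l// IM.
have uchirp : unif_continuous_on (ball S)
    (fun t => chirp (- omega) r t *: window_integral F h t).
  apply: (@unif_continuous_on_scale _ _ _ _ _
    (2 * (`|- omega| * (r * S `^ (r - 1)))) M) => //.
  - by rewrite !mulr_ge0 ?powR_ge0//; lra.
  - by move=> x _; rewrite cabs_chirp.
  - by move=> x y [_ xS] [_ yS]; exact: chirp_lipschitz.
move=> e e0; have [d d0 Id] := uchirp _ (mulr_gt0 h0 e0).
exists d => // x y bx yb xy; rewrite /demodulated_mean.
rewrite !scalerA ![chirp _ _ _ * _]mulrC -!scalerA -scalerBr rnormZr ger0_norm//.
by rewrite ler_pdivrMl//; exact: Id.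
Qed.

(** Far from 0 the mean is within e of the boundary terms, which are uniformly
    continuous and bounded there; near 0 everything is. *)
Lemma demodulated_mean_BUC : omega != 0 -> 2 <= r -> 0 < h ->
  unif_continuous_on J (demodulated_mean f omega r h) /\
  exists M, forall t, J t -> rnorm (demodulated_mean f omega r h t) <= M.
Proof.
move=> omega0 r2 h0.
have [uW [T1 [M1 WM]]] := unif_continuous_far_boundary Jup uf omega0 r2 h0.
have far := demodulated_mean_far Jup uf omega0 r2 h0.
split.
- apply: unif_continuous_glue => [S|e e0].
    by have [] := demodulated_mean_ball S r2 h0.
  have e30 : 0 < e / 3 by lra.
  have [T phiW] := far _ e30; have [T' [d d0 Wd]] := uW _ e30.
  exists (Num.max T T'); exists d => // x y Jx Jy.
  rewrite !ge_max => /andP[xT xT'] /andP[yT yT'] xy.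
  have := phiW x Jx xT; have := phiW y Jy yT; have := Wd x y Jx Jy xT' yT' xy.
  rewrite (rnormBC (demodulated_mean f omega r h y)).
  set px := demodulated_mean _ _ _ _ x; set py := demodulated_mean _ _ _ _ y.
  set wx := demodulated_boundary _ _ _ _ x; set wy := demodulated_boundary _ _ _ _ y.
  by have := rnorm_dist3 wx px py; have := rnorm_dist3 wy wx py; lra.
- have [T phiW] := far 1 ltr01.
  have [_ [M0 phiM]] := demodulated_mean_ball (Num.max T T1) r2 h0.
  exists (Num.max M0 (M1 + 1)) => t Jt; rewrite le_max.
  case: (leP `|t| (Num.max T T1)) => tT; first by rewrite phiM.
  apply/orP; right; move: (ltW tT); rewrite ge_max => /andP[tT0 tT1].
  have := phiW t Jt tT0; have := WM t Jt tT1.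
  set p := demodulated_mean _ _ _ _ t; set w := demodulated_boundary _ _ _ _ t.
  by have := rnormD (p - w) w; rewrite subrK; lra.
Qed.
End MeanIsDemodulatedBUC.

(** * The two inclusions *)

Section Domain.
Context {R : realType} {X : completeNormedModType R[i]}.
Variables (J : set R).

Lemma admissible_domain_up : admissible_domain J ->
  forall x y, J x -> x <= y -> J y.
Proof.
move=> [[a [->|->]]|->] x y //=; rewrite !in_itv /= !andbT => ax xy.
- exact: le_trans xy.
- exact: lt_le_trans xy.
Qed.

Lemma valL_scale (g : R -> R[i]) (f : J -> X) :
  'valL_0 (fun t : J => g (set_val t) *: f t) = (fun u => g u *: 'valL_0 f u).
Proof.
apply/funext => u; rewrite /valL_ /= oinv_set_val.
by case: insubP => [t _ <-|_] //=; rewrite scaler0.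
Qed.

(** On a segment that is empty or reduced to a point a constant function agrees
    with F, and no grid is available. *)
Lemma L1loc_chirp (omega r : R) (f : J -> X) : 2 <= r ->
  (forall x y, J x -> x <= y -> J y) -> unif_continuous_on J ('valL_0 f) ->
  L1loc (fun t : J => chirp omega r (set_val t) *: f t).
Proof.
move=> r2 Jup uf a b abJ; rewrite valL_scale.
pose F := chirped omega r ('valL_0 f); rewrite -[Z in bochner_integrable _ _ Z]/F.
have mI := completed_measurable_itv (`[a, b]).
have fI := segment_measure_fin a b.
case: (ltP a b) => ab.
  have ba0 : 0 < b - a by rewrite subr_gt0.
  have := @bochner_integrable_segment _ _ F a (b - a) ba0.
  rewrite addrC subrK; apply.
  have uF := unif_continuous_chirp_ball omega Jup uf (`|a| + `|b|) r2.
  apply: unif_continuous_on_sub uF => u uab; split; first exact: abJ.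
  move: uab; rewrite /= in_itv /= => /andP[au ub].
  have := ler_norm b; have := ler_norm (- a); rewrite normrN => na nb.
  by rewrite ler_norml; have := normr_ge0 a; have := normr_ge0 b;
    move=> *; apply/andP; split; lra.
exists (fun=> cst (F a)); apply: uniform_bochner_approx => //.
- move=> n; split; first exact: finite_image_cst.
  move=> x; rewrite preimage_cst; case: ifP => _; first exact: measurableT.
  exact: measurable0.
- move=> e e0; apply: nearW => n t; rewrite /= in_itv /= => /andP[at_ tb].
  have -> : t = a by apply/eqP; rewrite eq_le at_ (le_trans tb).
  by rewrite /cst subrr rnorm0 ltW.
Qed.

End Domain.

Lemma mul_class_sub {R : realType} {X : normedModType R[i]} (J : set R)
    (g : R -> R[i]) (B C : set (J -> X)) :
  B `<=` C -> mul_class g B `<=` mul_class g C.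
Proof. by move=> BC _ [f /BC Cf <-]; exists f. Qed.

Lemma mean_class_sub {R : realType} {X : normedModType R[i]} (J : set R)
    (B C : set (J -> X)) :
  B `<=` C -> mean_class B `<=` mean_class C.
Proof. by move=> BC f [fL fB]; split=> // h h0; exact/BC/fB. Qed.

Theorem mainTheorem10 (R : realType) (X : completeNormedModType R[i])
    (hX : exists x : X, x != 0)
    (J : set R) (hJ : admissible_domain J)
    (omega r : R) (homega : omega != 0) (hr : 2 <= r)
    (A : set (J -> X)) (hBUC : BUC X J `<=` A) (hUC : A `<=` UC X J) :
  mul_class (chirp omega r) A
    `<=` mean_class (mul_class (chirp omega r) (BUC X J)) /\
  mean_class (mul_class (chirp omega r) (BUC X J))
    `<=` mean_class (mul_class (chirp omega r) A).
Proof.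
split; last exact/mean_class_sub/mul_class_sub.
have Jup := admissible_domain_up hJ.
move=> _ [f /hUC /UC_valL uf <-]; split; first exact: L1loc_chirp.
move=> h h0.
exists (fun t : J => demodulated_mean ('valL_0 f) omega r h (set_val t)).
- apply/BUC_valL.
  have [uphi [M phiM]] := demodulated_mean_BUC Jup uf homega hr h0.
  have valE x : J x -> 'valL_0 (fun t : J =>
      demodulated_mean ('valL_0 f) omega r h (set_val t)) x =
      demodulated_mean ('valL_0 f) omega r h x.
    move=> Jx; pose t : J := exist _ x (mem_set Jx).
    by rewrite -[x]/(set_val t) valLE.
  split=> [e e0|]; last by exists M => x Jx; rewrite valE// phiM.
  have [d d0 phid] := uphi e e0; exists d => // x y Jx Jy xy.
  by rewrite !valE// phid.
- apply/funext => t; rewrite /mean valL_scale /demodulated_mean !scalerA.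
  by rewrite mulrA [chirp omega r _ * _]mulrC chirp_demodulate mul1r.
Qed.
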